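(* Let $X$ be a metric space and let $U:\mathcal P(\Sigma^{\mathbb N})\to X$ be continuous with respect to the weak topology. Let $C\subseteq X$ be a subset of $X$. Fix a continuous function $\Phi:\Sigma^{\mathbb N}\to\mathbb R$ with $\Phi<0$ and let $\mathfrak f(C)$ be the unique real number such that $$\limsup_{r\searrow0}\overline P^U_{B(C,r)}(\mathfrak f(C)\,\Phi)=0;$$ alternatively, $\mathfrak f(C)$ is the unique real number such that $\limsup_{r\searrow0}\sigma_{\mathrm{rad}}\big(\zeta^{\mathrm{dyn},U}_{B(C,r)}(\mathfrak f(C)\,\Phi;\cdot)\big)=1$. Then $$\mathfrak f(C)=\sup_{\mu\in\mathcal P_S(\Sigma^{\mathbb N}),\ U\mu\in\overline C}\ -\frac{h(\mu)}{\int\Phi\,d\mu}.$$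
   Context: Fix a positive integer $N$; $\Sigma^{\mathbb N}=\{1,\dots,N\}^{\mathbb N}$ is the space of infinite strings (product topology), $\Sigma^n=\{1,\dots,N\}^n$ the strings of length $n$; $|\mathbf i|$ is the length of a finite string $\mathbf i$ and $[\mathbf i]=\{\mathbf j\in\Sigma^{\mathbb N}: \mathbf j \text{ begins with } \mathbf i\}$ its cylinder. $S(i_1i_2\dots)=i_2i_3\dots$ is the shift. $\mathcal P(\Sigma^{\mathbb N})$ denotes the Borel probability measures on $\Sigma^{\mathbb N}$ and $\mathcal P_S(\Sigma^{\mathbb N})$ the shift-invariant ones, both with the weak topology; $h(\mu)$ is the measure-theoretic entropy of $\mu\in\mathcal P_S(\Sigma^{\mathbb N})$ with respect to $S$. For $n\ge1$ let $L_n:\Sigma^{\mathbb N}\to\mathcal P(\Sigma^{\mathbb N})$, $L_n\mathbf i=\frac1n\sum_{k=0}^{n-1}\delta_{S^k\mathbf i}$, and $UL_n[\mathbf i]=\{U(L_n\mathbf u):\mathbf u\in[\mathbf i]\}$. For $C\subseteq X$ and continuous $\varphi:\Sigma^{\mathbb N}\to\mathbb R$ put $$Z_n(C,\varphi)=\sum_{|\mathbf i|=n,\ UL_n[\mathbf i]\subseteq C}\ \sup_{\mathbf u\in[\mathbf i]}\exp\sum_{k=0}^{n-1}\varphi(S^k\mathbf u).$$ The upper multifractal pressure is $\overline P^U_C(\varphi)=\limsup_n\frac1n\log Z_n(C,\varphi)$. The dynamical multifractal zeta-function is the power series $\zeta_C^{\mathrm{dyn},U}(\varphi;z)=\sum_{n\ge1}\frac{z^n}{n}Z_n(C,\varphi)$,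 and $\sigma_{\mathrm{rad}}(f)\in[0,\infty]$ denotes the radius of convergence of a power series $f$. Conventions: empty sums are $0$, $\log0=-\infty$, $\sup\varnothing=-\infty$. $\overline C$ is the closure of $C$ and $B(C,r)=\{x\in X:\operatorname{dist}(x,C)<r\}$ is the open $r$-neighbourhood of $C$. *)

(* Defs.v *)
From HB Require Import structures.
From mathcomp Require Import all_boot all_order all_algebra.
From mathcomp Require Import all_classical all_reals all_analysis.

Set Implicit Arguments.
Unset Strict Implicit.
Unset Printing Implicit Defensive.

Import Order.TTheory GRing.Theory Num.Theory.
Import numFieldNormedType.Exports.

Local Open Scope classical_set_scope.
Local Open Scope ring_scope.

(** ** Kolmogorov-Sinai entropy *)

Section entropy.
Context d (T : measurableType d) (R : realType).
Variables (mu : probability T R) (f : T -> T).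

Definition invariant_measure : Prop :=
  forall A : set T, measurable A -> mu (f @^-1` A) = mu A.

(* A finite partition is encoded by its label function [xi : T -> 'I_k]; some
   labels may be unused, since atoms of measure 0 contribute 0 * ln 0 = 0. *)
Definition measurable_partition k (xi : T -> 'I_k) : Prop :=
  forall i, measurable (xi @^-1` [set i]).

Definition join_atom k (xi : T -> 'I_k) n (w : n.-tuple 'I_k) : set T :=
  [set x | forall j : 'I_n, xi (iter j f x) = tnth w j].

(* Shannon entropy of the join of the [f^-j xi], j < n *)
Definition join_entropy k (xi : T -> 'I_k) n : R :=
  \sum_(w : n.-tuple 'I_k)
    - (fine (mu (join_atom xi w)) * ln (fine (mu (join_atom xi w)))).

(* The limit exists as soon as [mu] is [f]-invariant. *)
Definition partition_entropy k (xi : T -> 'I_k) : R :=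
  limn (fun n => n%:R^-1 * join_entropy xi n).

Definition entropy : \bar R :=
  ereal_sup [set h | exists k (xi : T -> 'I_k),
    measurable_partition xi /\ h = (partition_entropy xi)%:E].

End entropy.

(** ** The full shift *)

(* The alphabet has [N.+1] letters, i.e., an arbitrary positive number. *)
Definition strings (N : nat) : Type :=
  {ptws nat -> discrete_topology 'I_N.+1}.

HB.instance Definition _ N := Topological.on (strings N).
HB.instance Definition _ N :=
  isPointed.Build (strings N) (fun _ => ord0 : discrete_topology 'I_N.+1).

Definition borel_strings (N : nat) : Type :=
  g_sigma_algebraType (@open (strings N)).

HB.instance Definition _ N := Measurable.on (borel_strings N).

Definition shift_map N (u : strings N) : strings N := fun n => u n.+1.

Definition cylinder N n (i : n.-tuple 'I_N.+1) : set (strings N) :=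
  [set u | forall k : 'I_n, u k = tnth i k].

Definition birkhoff_sum (R : realType) N (phi : strings N -> R) n u : R :=
  \sum_(k < n) phi (iter k (@shift_map N) u).

(** ** Probability measures with the weak topology *)

Section weak_topology.
Variables (R : realType) (N : nat).

Definition test_function : Type := {g : strings N -> R | continuous g}.

HB.instance Definition _ := gen_eqMixin test_function.
HB.instance Definition _ := gen_choiceMixin test_function.

Definition integrals (mu : probability (borel_strings N) R) :
    {ptws test_function -> R} :=
  fun g => \int[mu]_u (sval g u).

(* The coarsest topology making [mu |-> \int g dmu] continuous for every
   continuous [g]. *)
Definition weak_probability : Type := initial_topology integrals.

HB.instance Definition _ := Topological.on weak_probability.

End weak_topology.

(** ** Empirical measures *)

Section empirical.
Variables (R : realType) (N : nat).

Definition orbit_average (m : nat) (u : borel_strings N) :=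
  mscale (m.+1%:R^-1 : R)%:nng
    (msum (fun k => \d_(iter k (@shift_map N) u : borel_strings N)) m.+1).

HB.instance Definition _ m u := Measure.on (orbit_average m u).

Let orbit_average_setT m u : orbit_average m u setT = 1%E.
Proof.
rewrite /orbit_average /mscale /=.
have -> : msum (fun k => \d_(iter k (@shift_map N) u : borel_strings N)) m.+1 setT
    = \sum_(k < m.+1) (1%:E : \bar R) by apply: eq_bigr => k _; exact: diracT.
by rewrite sumEFin sumr_const card_ord -EFinM mulVf// pnatr_eq0.
Qed.

HB.instance Definition _ m u :=
  Measure_isProbability.Build _ _ _ (orbit_average m u)
    (orbit_average_setT m u).

(* L_n; the value at n = 0 is irrelevant. *)
Definition empirical (n : nat) (u : strings N) :
    probability (borel_strings N) R :=
  if n is m.+1 then orbit_average m u else \d_(u : borel_strings N).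

End empirical.

(** ** Multifractal pressure and zeta-function *)

Section pressure.
Variables (R : realType) (N : nat) (X : metricType R).
Variables (U : weak_probability R N -> X) (C : set X) (phi : strings N -> R).

Definition partition_sum (n : nat) : R :=
  \sum_(i : n.-tuple 'I_N.+1 |
        `[< [set U (empirical R n u) | u in cylinder i] `<=` C >])
     sup [set expR (birkhoff_sum phi n u) | u in cylinder i].

(* [lne 0 = -oo] *)
Definition upper_pressure : \bar R :=
  limn_esup (fun n => (n%:R^-1)%:E * lne (partition_sum n)%:E)%E.

(* Power series coefficients; the one at n = 0 is 0, because [0^-1 = 0]. *)
Definition zeta_coef (n : nat) : R := n%:R^-1 * partition_sum n.

End pressure.

(* For real coefficients it is enough to test convergence at real points:
   convergence at z implies absolute convergence at all complex w with
   |w| < |z|. *)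
Definition convergence_radius (R : realType) (a : nat -> R) : \bar R :=
  ereal_sup [set `|z|%:E | z in
    [set z : R | cvgn (series (fun n => a n * z ^+ n))]].

(* The infimum is +oo when [C] is empty. *)
Definition neighborhood (R : realType) (X : metricType R) (C : set X) (r : R) :
    set X :=
  [set x | (ereal_inf [set (mdist x c)%:E | c in C] < r%:E)%E].

(* Main.v *)
(* The entropy of the full shift is governed by counting words. If mu is
   invariant and p is the law of its words of length m, then the concatenations
   of q words of length m whose empirical frequencies are close to p number at
   least exp(q (H(p) - o(1))) (Chebyshev), and along each of them the empirical
   measure is close to mu, with no ergodicity assumption; as H(p) >= m h(mu),
   the pressure is at least h(mu) + int phi dmu as soon as U mu is in the closure
   of C. Conversely, by compactness of the space of systems of word weights there
   is a system p all of whose neighbourhoods carry the full pressure of every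
   B(C, r). It defines an invariant mu with U mu in the closure of C, and the words
   of length n whose m-word frequencies are close to p number at most
   exp(n (H(p)/m + o(1))): on average over the m phases, the log-likelihood of a
   splitting into blocks of length m is given by the frequencies. Hence the
   limit of the pressures is the maximum of h(mu) + int phi dmu over these mu,
   which for phi = s Phi vanishes exactly when s is the maximum of
   - h(mu) / int Phi dmu. *)
Require Import Defs.
From HB Require Import structures.
From mathcomp Require Import all_boot all_order all_algebra.
From mathcomp Require Import all_classical all_reals all_analysis.
From mathcomp Require Import ring lra zify.
Import Order.TTheory GRing.Theory Num.Theory.
Import numFieldNormedType.Exports.
Local Open Scope classical_set_scope.
Local Open Scope ring_scope.

Set Implicit Arguments.
Unset Strict Implicit.

(** * Finite entropy *)

Section finite_entropy.
Variable R : realType.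
Implicit Types (x y : R) (I J : finType).

(** Measures are handled through the laws of their finite words. Continuity of [U] enters in one
    form: measures with close word laws have close images. Compactness is then Tychonoff's theorem
    for functions from words to [0, 1], and the limiting measure is rebuilt from its word weights by
    an explicit coding of the unit interval. Two obstacles shape the rest. The entropy is a supremum
    over all finite measurable partitions, whereas the lower bound counts words; hence the
    approximation of measurable sets by unions of cylinders, which bounds the entropy of any
    partition by that of the words. In the upper bound one measure has to serve all block lengths;
    the weights are therefore fixed before the length, and this takes the place of upper
    semicontinuity of the entropy. What is asked of the pressures is little: the upper bound starts
    from their nonnegativity for all radii, and the lower bound concerns any neighbourhood of
    [U mu]. *)

Definition eta x : R := - (x * ln x).

Lemma eta_ge0 x : x <= 1 -> 0 <= eta x.
Proof.
move=> x1; rewrite /eta oppr_ge0.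
have [x0|x0] := leP x 0; first by rewrite ln0// mulr0.
by apply: mulr_ge0_le0; [exact: ltW | exact: ln_le0].
Qed.

Lemma ln_le_subr1 x : 0 < x -> ln x <= x - 1.
Proof. by move=> x0; rewrite -[X in ln X](subrKC 1) le_ln1Dx// ltrBrDl subrr. Qed.

Lemma eta_le_oneB x : 0 <= x -> eta x <= 1 - x.
Proof.
rewrite le_eqVlt => /predU1P[<-|x0]; first by rewrite /eta mul0r oppr0 addr0.
have := ln_le_subr1 (x := x^-1); rewrite invr_gt0 => /(_ x0).
rewrite lnV ?posrE// => h.
rewrite /eta -mulrN (le_trans (ler_wpM2l (ltW x0) h))//.
by rewrite mulrBr mulfV ?gt_eqF// mulr1.
Qed.

(** With [y] the square root of [x], [eta x = 2 * y * eta y] and [eta y <= 1]. This is the modulus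
    of continuity at 0 that makes rare errors cost little entropy. *)
Lemma eta_le_sqrt x : 0 <= x -> eta x <= 2 * Num.sqrt x.
Proof.
rewrite le_eqVlt => /predU1P[<-|x0]; first by rewrite /eta mul0r oppr0 sqrtr0 mulr0.
set y := Num.sqrt x; have y0 : 0 < y by rewrite sqrtr_gt0.
have -> : eta x = y * 2 * eta y.
  rewrite /eta -[x in ln x]sqr_sqrtr ?(ltW x0)// lnXn -/y// mulr2n.
  by rewrite -[x in x * _]sqr_sqrtr ?(ltW x0)// -/y; ring.
have y1 : eta y <= 1 by rewrite (le_trans (eta_le_oneB (ltW y0)))// lerBlDr lerDl ltW.
by rewrite [2 * y]mulrC ger_pMr// mulr_gt0.
Qed.

(* Gibbs' inequality, from [ln t <= t - 1] at [t = q j / p j]. *)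
Lemma gibbs J (p q : J -> R) :
    (forall j, 0 <= p j) -> (forall j, 0 <= q j) ->
    (forall j, q j = 0 -> p j = 0) -> \sum_j q j <= \sum_j p j ->
  \sum_j eta (p j) <= \sum_j - (p j * ln (q j)).
Proof.
move=> p0 q0 pq le_qp; rewrite -subr_ge0 -sumrB.
rewrite (@le_trans _ _ (\sum_j p j - \sum_j q j)) ?subr_ge0// -sumrB.
apply: ler_sum => j _; rewrite /eta.
have := p0 j; rewrite le_eqVlt => /predU1P[pj0|pj0].
  by rewrite -pj0 !mul0r subrr sub0r oppr_le0.
have qj0 : 0 < q j.
  by rewrite lt_def q0 andbT; apply/eqP => /pq pj; rewrite pj ltxx in pj0.
have := ln_le_subr1 (divr_gt0 qj0 pj0).
rewrite ln_div ?posrE// => /(ler_wpM2l (ltW pj0)).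
have -> : p j * (q j / p j - 1) = q j - p j by field; rewrite gt_eqF.
lra.
Qed.

(** Each [p j] is at most the sum, and [ln] is monotone. Merging atoms thus lowers the entropy. *)
Lemma eta_sum_le J (P : pred J) (p : J -> R) : (forall j, 0 <= p j) ->
  eta (\sum_(j | P j) p j) <= \sum_(j | P j) eta (p j).
Proof.
move=> p0; rewrite {1}/eta mulr_suml -sumrN; apply: ler_sum => j Pj.
rewrite /eta lerN2; have := p0 j; rewrite le_eqVlt => /predU1P[<-|pj0].
  by rewrite !mul0r.
have le_s : p j <= \sum_(j | P j) p j.
  by rewrite (bigD1 j)//= lerDl; exact: sumr_ge0.
by apply: ler_wpM2l; rewrite ?(ltW pj0)// ler_ln// posrE (lt_le_trans pj0).
Qed.

End finite_entropy.

(** * Entropy of random variables with finitely many values *)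

Section random_labels.
Context d (T : measurableType d) (R : realType).
Variable mu : probability T R.
Implicit Types I J : finType.

(** Partitions are measurable maps to a finite type, so that a join is a pair and a coarser
    partition a composition. *)
Definition label I (X : T -> I) : Prop := forall a, measurable (X @^-1` [set a]).

Definition law I (X : T -> I) (a : I) : R := fine (mu (X @^-1` [set a])).

Definition shannon I (X : T -> I) : R := \sum_a eta (law X a).

Lemma law_ge0 I (X : T -> I) a : 0 <= law X a.
Proof. by rewrite /law fine_ge0. Qed.

Lemma label_preimage I (X : T -> I) (P : pred I) : label X ->
  measurable (X @^-1` [set a | P a]).
Proof.
move=> mX; rewrite (_ : _ @^-1` _ = \bigcup_(a in [set a | P a]) (X @^-1` [set a])).
  by apply: fin_bigcup_measurable => // a _; exact: mX.
apply/seteqP; split => [x /= Px|x [a /= Pa ->]//].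
by exists (X x).
Qed.

Lemma label_comp I J (X : T -> I) (g : I -> J) : label X -> label (g \o X).
Proof.
move=> mX b; rewrite comp_preimage.
have -> : g @^-1` [set b] = [set a | g a == b].
  by apply/seteqP; split => a /= /eqP.
exact: label_preimage.
Qed.


Lemma prob_label I (X : T -> I) (P : pred I) : label X ->
  fine (mu (X @^-1` [set a | P a])) = \sum_(a | P a) law X a.
Proof.
move=> mX; apply: EFin_inj; rewrite fineK ?fin_num_measure//; last first.
  exact: label_preimage.
rewrite -sumEFin (_ : _ @^-1` _ = \bigcup_(a in [set a | P a]) (X @^-1` [set a])).
  rewrite measure_fin_bigcup; last 3 first.
  - exact: finite_finset.
  - apply/trivIsetP => a b _ _ ab; apply/seteqP; split => x //= [-> /eqP].
    by rewrite (negbTE ab).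
  - by move=> a _; exact: mX.
  transitivity (\sum_(a <- enum P) mu (X @^-1` [set a]))%E.
    rewrite [RHS]fsbig_seq ?enum_uniq//; apply: eq_fsbigl.
    by apply/seteqP; split => a /=; rewrite mem_enum.
  rewrite big_enum/=; apply: eq_bigr => a _; by rewrite /law fineK// fin_num_measure//; exact: mX.
apply/seteqP; split => [x /= Px|x [a /= Pa ->]//].
by exists (X x).
Qed.

Lemma law_sum1 I (X : T -> I) : label X -> \sum_a law X a = 1.
Proof.
move=> mX; rewrite -prob_label// (_ : _ @^-1` _ = setT) ?probability_setT//.
by apply/seteqP; split.
Qed.

Lemma law_comp I J (X : T -> I) (g : I -> J) b : label X ->
  law (g \o X) b = \sum_(a | g a == b) law X a.
Proof.
move=> mX; rewrite -prob_label// /law comp_preimage; congr (fine (mu (_ @^-1` _))).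
by apply/seteqP; split => a /= /eqP.
Qed.

Lemma shannon_comp I J (X : T -> I) (g : I -> J) : label X ->
  shannon (g \o X) <= shannon X.
Proof.
move=> mX; rewrite /shannon (partition_big g predT)//=; apply: ler_sum => b _.
by rewrite law_comp// eta_sum_le// => a; exact: law_ge0.
Qed.

Lemma law_le1 I (X : T -> I) a : label X -> law X a <= 1.
Proof.
move=> mX; rewrite -(@law_sum1 _ X)// (bigD1 a)//= lerDl.
by apply: sumr_ge0 => b _; exact: law_ge0.
Qed.

Lemma shannon_ge0 I (X : T -> I) : label X -> 0 <= shannon X.
Proof. by move=> mX; apply: sumr_ge0 => a _; rewrite eta_ge0// law_le1. Qed.

Lemma label_pair I J (X : T -> I) (Y : T -> J) : label X -> label Y ->
  label (fun x => (X x, Y x)).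
Proof.
move=> mX mY [a b].
rewrite (_ : _ @^-1` _ = X @^-1` [set a] `&` Y @^-1` [set b]).
  by apply: measurableI; [exact: mX | exact: mY].
by apply/seteqP; split => x /= [-> ->].
Qed.

(** Gibbs' inequality against the product of the two marginals; the cross entropy of the joint law
    with this product is the sum of the two entropies. *)
Lemma shannon_pair I J (X : T -> I) (Y : T -> J) : label X -> label Y ->
  shannon (fun x => (X x, Y x)) <= shannon X + shannon Y.
Proof.
move=> mX mY; set Z := fun x => _; have mZ : label Z by exact: label_pair.
have lX a : law X a = \sum_b law Z (a, b).
  rewrite (_ : X = fst \o Z)// law_comp// [RHS](reindex_onto snd (pair a))//=.
  by apply: eq_big => -[a' b] /=; [rewrite xpair_eqE eqxx andbT eq_sym | move=> /eqP ->].
have lY b : law Y b = \sum_a law Z (a, b).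
  rewrite (_ : Y = snd \o Z)// law_comp// [RHS](reindex_onto fst (pair^~ b))//=.
  by apply: eq_big => -[a' b'] /=; [rewrite xpair_eqE eqxx eq_sym | move=> /eqP ->].
pose q c := law X c.1 * law Y c.2.
have q0 c : 0 <= q c by rewrite mulr_ge0// law_ge0.
have lZX a b : law Z (a, b) <= law X a.
  by rewrite lX (bigD1 b)//= lerDl sumr_ge0// => ? _; exact: law_ge0.
have lZY a b : law Z (a, b) <= law Y b.
  by rewrite lY (bigD1 a)//= lerDl sumr_ge0// => ? _; exact: law_ge0.
have qZ c : q c = 0 -> law Z c = 0.
  case: c => a b /eqP; rewrite mulf_eq0/= => /orP[]/eqP e.
    by apply/eqP; rewrite eq_le law_ge0 andbT -e lZX.
  by apply/eqP; rewrite eq_le law_ge0 andbT -e lZY.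
have pairE (f : I * J -> R) : \sum_c f c = \sum_a \sum_b f (a, b).
  by rewrite pair_bigA; apply: eq_bigr => -[].
rewrite /shannon (le_trans (@gibbs _ _ (law Z) q _ _ _ _))//.
- by move=> c; exact: law_ge0.
- rewrite law_sum1// pairE.
  rewrite (eq_bigr (law X)) ?law_sum1// => a _.
  by rewrite /q/= -mulr_sumr law_sum1// mulr1.
rewrite le_eqVlt; apply/orP; left; apply/eqP.
have -> : \sum_a eta (law X a) = \sum_c - (law Z c * ln (law X c.1)).
  rewrite pairE/=.
  by apply: eq_bigr => a _; rewrite sumrN -mulr_suml -lX.
have -> : \sum_a eta (law Y a) = \sum_c - (law Z c * ln (law Y c.2)).
  rewrite pairE exchange_big/=.
  by apply: eq_bigr => a _; rewrite sumrN -mulr_suml -lY.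
rewrite -big_split/=; apply: eq_bigr => -[a b] _ /=.
have [q0'|] := eqVneq (q (a, b)) 0; first by rewrite qZ// !mul0r oppr0 addr0.
rewrite mulf_eq0/= negb_or => /andP[a0 b0].
rewrite /q /= lnM ?posrE ?lt_def ?a0 ?b0 ?law_ge0//.
by ring.
Qed.

End random_labels.

(** * Subadditive sequences *)

Section fekete.
Variable R : realType.

(** Subadditivity gives only [0 <= a 0], so the inequality may fail for the factor 0; hence
    [n.+1]. *)
Lemma subadditive_mul_le (a : nat -> R) k n :
  (forall m n, a (m + n)%N <= a m + a n) -> a (k * n.+1)%N <= n.+1%:R * a k.
Proof.
move=> sub; elim: n => [|n ih]; first by rewrite muln1 mul1r.
by rewrite mulnS (le_trans (sub _ _))// -[n.+2]addn1 natrD mulrDl mul1r addrC lerD2r.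
Qed.

(** The limit is the infimum of the quotients over positive indices: division of [n] by a nearly
    optimal [m] bounds [a n] by [n] times the quotient at [m], up to a remainder that is bounded in
    [n]. *)
Lemma fekete (a : nat -> R) : (forall n, 0 <= a n) ->
    (forall m n, a (m + n)%N <= a m + a n) ->
  cvgn (fun n => n%:R^-1 * a n) /\
  forall m, (0 < m)%N -> limn (fun n => n%:R^-1 * a n) <= m%:R^-1 * a m.
Proof.
move=> a0 sub; pose u n := n%:R^-1 * a n.
pose S := [set u m | m in [set m | (0 < m)%N]].
have hS : has_inf S.
  split; first by exists (u 1%N), 1%N.
  by exists 0 => _ [m _ <-]; rewrite /u mulr_ge0// invr_ge0.
have infS m : (0 < m)%N -> inf S <= u m.
  by move=> m0; apply: ge_inf; [exact: hS.2 | exists m].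
suff cu : u @ \oo --> inf S.
  split; first by apply/cvg_ex; exists (inf S).
  by move=> m m0; rewrite (cvg_lim _ cu)//; exact: infS.
apply/cvgrPdist_le => e e0.
have e2 : 0 < e / 2 by rewrite divr_gt0.
have [_ [m m0 <-] um] := inf_adherent e2 hS.
pose B := \sum_(k < m) a k.
have aB r : (r < m)%N -> a r <= B.
  by move=> rm; rewrite /B (bigD1 (Ordinal rm))//= lerDl sumr_ge0.
have [M HM] : exists M : nat, B / (e / 2) <= M%:R.
  by exists (Num.truncn (B / (e / 2))).+1; rewrite ltW// truncnS_gt.
exists (maxn M 1) => // n /=; rewrite geq_max => /andP[Mn n0].
rewrite distrC ger0_norm ?subr_ge0 ?infS// lerBlDl.
have n0' : 0 < n%:R :> R by rewrite ltr0n.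
have m0' : 0 < m%:R :> R by rewrite ltr0n.
have an : a n <= n%:R * u m + B.
  (* If [n < m], the bound on multiples does not apply, and [a n] is itself a remainder. *)
  rewrite {1}(divn_eq n m); have [->|q0] := posnP (n %/ m).
    rewrite mul0n add0n (le_trans (aB _ (ltn_pmod _ m0)))// lerDr mulr_ge0//.
    by rewrite /u mulr_ge0// invr_ge0.
  rewrite (le_trans (sub _ _))// lerD//; last by rewrite aB// ltn_pmod.
  rewrite mulnC -(prednK q0) (le_trans (subadditive_mul_le _ _ sub))// prednK//.
  rewrite /u mulrA ler_wpM2r// ler_pdivlMr// -natrM ler_nat.
  exact: leq_trunc_div.
have uS : u n <= u m + B / n%:R.
  rewrite /u mulrC ler_pdivrMr// mulrDl mulfVK ?gt_eqF// mulrC.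
  by rewrite [leRHS]addrC [X in _ + X]mulrC addrC in an *.
have Bn : B / n%:R <= e / 2.
  rewrite ler_pdivrMr// mulrC -ler_pdivrMr// (le_trans HM)// ler_nat//.
rewrite (le_trans uS)// (le_trans (lerD (ltW um) Bn))//.
by rewrite -addrA -splitr.
Qed.

End fekete.

(** * Words and their number *)

Section words.
Variable N : nat.
Local Notation A := 'I_N.+1.
Implicit Types u v : strings N.

Definition word n u : n.-tuple A := [tuple (u k : A) | k < n].

(** A canonical point of the cylinder of [w], at which functions of strings are evaluated. *)
Definition padded (w : seq A) : strings N := fun k => nth ord0 w k.

Lemma wordP n u v : word n u = word n v <-> forall k, (k < n)%N -> u k = v k.
Proof.
split=> [uv k kn|uv]; last by apply: eq_from_tnth => k; rewrite !tnth_mktuple uv.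
by have := congr1 (fun w => tnth w (Ordinal kn)) uv; rewrite !tnth_mktuple.
Qed.

Lemma word_le m n u v : (m <= n)%N -> word n u = word n v -> word m u = word m v.
Proof. by move=> mn /wordP uv; apply/wordP => k km; rewrite uv// (leq_trans km). Qed.

Lemma word_padded n (i : n.-tuple A) : word n (padded i) = i.
Proof. by apply: eq_from_tnth => k; rewrite tnth_mktuple /padded (tnth_nth ord0). Qed.

Lemma word_eqP n u (i : n.-tuple A) :
  word n u = i <-> forall k, (k < n)%N -> u k = nth ord0 i k.
Proof. by rewrite -[X in _ = X]word_padded wordP. Qed.

Lemma cylinderE n (i : n.-tuple A) : cylinder i = [set u | word n u = i].
Proof.
apply/seteqP; split=> u /=.
  by move=> ui; apply: eq_from_tnth => k; rewrite tnth_mktuple ui.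
by move=> <- k; rewrite tnth_mktuple.
Qed.

Lemma iter_shift t u k : iter t (@shift_map N) u k = u (t + k)%N.
Proof. by elim: t k => // t ih k; rewrite iterS /shift_map ih addnS. Qed.

Lemma word_shift t m u v : word (t + m) u = word (t + m) v ->
  word m (iter t (@shift_map N) u) = word m (iter t (@shift_map N) v).
Proof.
move=> /wordP uv; apply/wordP => k km.
by rewrite !iter_shift uv// ltn_add2l.
Qed.

End words.
Arguments word : simpl never.

Lemma ler_sum_inj (R : numDomainType) (I J : finType) (f : I -> J) (P : pred I)
    (Q : pred J) (F : J -> R) :
  injective f -> (forall i, P i -> Q (f i)) -> (forall j, 0 <= F j) ->
  \sum_(i | P i) F (f i) <= \sum_(j | Q j) F j.
Proof.
move=> injf PQ F0; rewrite -(big_imset F (h := f) (A := P))/=; last by move=> ? ? _ _; exact: injf.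
rewrite [leLHS]big_mkcond [leRHS]big_mkcond; apply: ler_sum => j _.
case: ifPn => [/imsetP[i Pi ->]|_]; first by rewrite PQ.
by case: ifP.
Qed.

(** * Typical words of independent letters *)

Section typical_words.
Variables (R : realType) (B : finType) (p : B -> R).
Hypotheses (p0 : forall b, 0 <= p b) (p1 : \sum_b p b = 1).

Let weight q (x : {ffun 'I_q -> B}) := \prod_j p (x j).

Definition occurrences q (x : {ffun 'I_q -> B}) b : R := \sum_j (x j == b)%:R.

Definition typical q (e : R) (x : {ffun 'I_q -> B}) :=
  [forall b, `|occurrences x b - q%:R * p b| <= q%:R * e].

Let weight_ge0 q (x : {ffun 'I_q -> B}) : 0 <= weight x.
Proof. exact: prodr_ge0. Qed.

(** Distributivity; under the Bernoulli law [weight] it says that functions of distinct letters are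
    independent. *)
Let sum_weight_prod q (f : 'I_q -> B -> R) :
  \sum_(x : {ffun 'I_q -> B}) (weight x * \prod_j f j (x j)) =
  \prod_j \sum_b p b * f j b.
Proof.
rewrite bigA_distr_bigA/=; apply: eq_bigr => x _.
by rewrite /weight -big_split.
Qed.

Let sum_weight q : \sum_(x : {ffun 'I_q -> B}) weight x = 1.
Proof.
transitivity (\sum_(x : {ffun 'I_q -> B}) (weight x * \prod_(j < q) 1)).
  by apply: eq_bigr => x _; rewrite big1 ?mulr1.
rewrite (sum_weight_prod (fun _ _ => 1)) big1// => j _.
by under eq_bigr do rewrite mulr1.
Qed.

(** Once the square is expanded, the terms with [j != k] vanish by independence, [g] being centred,
    and the [q] diagonal terms are at most 1 each. *)
Let variance q (g : B -> R) : \sum_b p b * g b = 0 -> (forall b, `|g b| <= 1) ->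
  \sum_(x : {ffun 'I_q -> B}) weight x * (\sum_j g (x j)) ^+ 2 <= q%:R.
Proof.
move=> g0 g1.
have -> : \sum_(x : {ffun 'I_q -> B}) weight x * (\sum_j g (x j)) ^+ 2 =
   \sum_(j < q) \sum_(k < q) \sum_(x : {ffun 'I_q -> B}) weight x * (g (x j) * g (x k)).
  under [RHS]eq_bigr do rewrite exchange_big/=.
  rewrite [RHS]exchange_big/=; apply: eq_bigr => x _.
  rewrite expr2 mulr_suml mulr_sumr; apply: eq_bigr => j _.
  by rewrite !mulr_sumr.
rewrite (@le_trans _ _ (\sum_(j < q) 1))//; last by rewrite sumr_const card_ord.
apply: ler_sum => j _.
(* The exponent counts the occurrences of [i] among [j] and [k], which writes the two factors as a
   product over all positions. *)
have E k : \sum_(x : {ffun 'I_q -> B}) weight x * (g (x j) * g (x k)) =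
    \prod_i \sum_b p b * g b ^+ ((i == j) + (i == k)).
  rewrite -(sum_weight_prod (fun i b => g b ^+ ((i == j) + (i == k)))).
  apply: eq_bigr => x _; congr (_ * _).
  under eq_bigr do rewrite exprD.
  have h l : \prod_i g (x i) ^+ (i == l) = g (x l).
    by rewrite (bigD1 l)//= eqxx expr1 big1 ?mulr1// => i /negbTE ->.
  by rewrite big_split/= !h.
rewrite (bigD1 j)//= [X in _ + X]big1 ?addr0; last first.
  move=> k kj; rewrite E (bigD1 j)//= eqxx eq_sym (negbTE kj) addn0.
  by under eq_bigr do rewrite expr1; rewrite g0 mul0r.
rewrite -(sum_weight q); apply: ler_sum => x _.
rewrite -[leRHS]mulr1 ler_wpM2l// -expr2 -(ger0_norm (sqr_ge0 _)) normrX.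
by rewrite exprn_ile1.
Qed.

Let occurrencesB q (x : {ffun 'I_q -> B}) b :
  occurrences x b - q%:R * p b = \sum_j ((x j == b)%:R - p b).
Proof. by rewrite sumrB sumr_const card_ord mulr_natl. Qed.

(* Chebyshev's inequality for independent letters of law [p] *)
Let sum_weight_typical q (e : R) : 0 < e -> (0 < q)%N ->
    2 * #|B|%:R <= q%:R * e ^+ 2 ->
  2^-1 <= \sum_(x : {ffun 'I_q -> B} | typical e x) weight x.
Proof.
move=> e0 q0 qB; have q0' : 0 < q%:R :> R by rewrite ltr0n.
have qe0 : 0 < (q%:R * e) ^+ 2 by rewrite exprn_gt0// mulr_gt0.
have := sum_weight q; rewrite (bigID (typical e))/=.
suff : \sum_(x : {ffun 'I_q -> B} | ~~ typical e x) weight x <= 2^-1 by lra.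
(* Union bound over the letters: for an atypical word, one of the quotients is at least 1. *)
rewrite (@le_trans _ _ (\sum_b \sum_(x : {ffun 'I_q -> B})
  weight x * (\sum_j ((x j == b)%:R - p b)) ^+ 2 / (q%:R * e) ^+ 2))//.
  rewrite exchange_big/= [leLHS]big_mkcond; apply: ler_sum => x _.
  have nn b : 0 <= weight x * (\sum_j ((x j == b)%:R - p b)) ^+ 2 / (q%:R * e) ^+ 2.
    by rewrite mulr_ge0 ?invr_ge0 ?(ltW qe0)// mulr_ge0// sqr_ge0.
  case: ifPn => [/forallPn[b]|_]; last by apply: sumr_ge0 => b _.
  rewrite -ltNge => xb; rewrite (bigD1 b)//= -[leLHS]addr0 lerD//; last first.
    by apply: sumr_ge0 => c _.
  rewrite -mulrA -[leLHS]mulr1 ler_wpM2l// ler_pdivlMr// mul1r.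
  rewrite -occurrencesB -[leRHS]ger0_norm ?sqr_ge0// normrX lerXn2r ?nnegrE ?normr_ge0 ?mulr_ge0 ?ler0n ?(ltW e0) ?(ltW xb)//.
rewrite (@le_trans _ _ (\sum_(b : B) q%:R / (q%:R * e) ^+ 2))//.
  apply: ler_sum => b _; rewrite -mulr_suml ler_wpM2r ?invr_ge0 ?(ltW qe0)//.
  apply: (@variance q (fun c => (c == b)%:R - p b)).
    under eq_bigr do rewrite mulrBr.
    rewrite sumrB -mulr_suml p1 mul1r (bigD1 b)//= eqxx mulr1 big1 ?addr0 ?subrr//.
    by move=> c /negbTE ->; rewrite mulr0.
  move=> c; have pb1 : p b <= 1 by rewrite -p1 (bigD1 b)//= lerDl sumr_ge0.
  have := p0 b; rewrite ler_norml; case: (c == b) => /=; lra.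
rewrite sumr_const -[leLHS]mulr_natl.
have -> : q%:R / (q%:R * e) ^+ 2 = (q%:R * e ^+ 2)^-1 by field; rewrite !gt_eqF.
rewrite ler_pdivrMr ?mulr_gt0 ?exprn_gt0//.
by rewrite -(ler_pM2l (_ : 0 < 2 :> R))// mulrA mulfV// mul1r.
Qed.

(** Typical words have total weight at least 1/2, while the log-likelihood of each is read off its
    letter frequencies, so that no single one has much weight. *)
Lemma card_typical_ge q (e : R) : 0 < e -> (0 < q)%N ->
    2 * #|B|%:R <= q%:R * e ^+ 2 ->
  2^-1 * expR (q%:R * (\sum_b eta (p b) - e * \sum_b `|ln (p b)|)) <=
    #|[pred x : {ffun 'I_q -> B} | typical e x]|%:R.
Proof.
move=> e0 q0 qB; set h := \sum_b eta _; set L := \sum_b _.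
rewrite -ler_pdivlMr ?expR_gt0// -expRN.
rewrite (le_trans (sum_weight_typical e0 q0 qB))//.
have -> E : #|[pred x : {ffun 'I_q -> B} | typical e x]|%:R * E =
    \sum_(x : {ffun 'I_q -> B} | typical e x) E.
  by rewrite sumr_const mulr_natl.
apply: ler_sum => x tx.
(* A letter of probability 0 makes the weight 0 and the bound trivial; otherwise the weight is the
   exponential of a sum of true logarithms. *)
have [x0|] := eqVneq (weight x) 0; first by rewrite x0 expR_ge0.
move=> /prodf_neq0 px.
have -> : weight x = expR (\sum_j ln (p (x j))).
  rewrite expR_sum; apply: eq_bigr => j _; rewrite lnK// posrE lt_def p0 px//.
rewrite ler_expR.
have -> : \sum_j ln (p (x j)) = \sum_b occurrences x b * ln (p b).
  rewrite (eq_bigr (fun j => \sum_b (x j == b)%:R * ln (p b))); last first.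
    move=> j _; rewrite (bigD1 (x j))//= eqxx mul1r big1 ?addr0// => b.
    by rewrite eq_sym => /negbTE ->; rewrite mul0r.
  by rewrite exchange_big/=; apply: eq_bigr => b _; rewrite mulr_suml.
have -> : \sum_b occurrences x b * ln (p b) = \sum_b (q%:R * - eta (p b)) +
    \sum_b (occurrences x b - q%:R * p b) * ln (p b).
  by rewrite -big_split; apply: eq_bigr => b _ /=; rewrite /eta; ring.
have : \sum_b (occurrences x b - q%:R * p b) * ln (p b) <= \sum_b q%:R * e * `|ln (p b)|.
  apply: ler_sum => b _; rewrite (le_trans (ler_norm _))// normrM ler_wpM2r//.
  by move/forallP : tx; exact.
rewrite -!mulr_sumr sumrN -/h -/L; lra.
Qed.

End typical_words.

(** * Counting words by their log-likelihood in blocks *)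

Section cross_entropy_count.
Variables (R : realType) (N m n : nat) (r : m.-tuple 'I_N.+1 -> R).
Hypotheses (m0 : (0 < m)%N) (r0 : forall w, 0 < r w) (r1 : \sum_w r w <= 1).

(** Near the end of [i] a block runs into the padding; it is still a function of [i]. *)
Let block t (i : n.-tuple 'I_N.+1) := word m (iter t (@shift_map N) (padded i)).

Let cost t i := - ln (r (block t i)).

Let cost_ge0 t i : 0 <= cost t i.
Proof.
rewrite oppr_ge0 ln_le0// (le_trans _ r1)// (bigD1 (block t i))//= lerDl.
by apply: sumr_ge0 => w _; exact: ltW.
Qed.

(** The number of blocks of phase [j], at the positions [j + m * l], that end inside the word. *)
Let len j := ((n - j) %/ m)%N.

Let block_bound j l : (j < m)%N -> (l < len j)%N -> (j + m * l + m <= n)%N.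
Proof.
move=> jm lL; have : (m * l.+1 <= n - j)%N.
  by rewrite (leq_trans _ (leq_trunc_div (n - j) m))// mulnC leq_mul2r lL orbT.
rewrite mulnS; have [nj|jn] := leqP n j.
  by move: lL; rewrite /len (eqP nj) div0n.
lia.
Qed.

Let phase_cost (j : 'I_m) i := \sum_(l < len j) cost (j + m * l) i.

(** A position [j + m * l] with [j < m] determines [j] and [l], so distinct phases use distinct
    positions; the other costs are nonnegative and are dropped. *)
Let sum_phase_cost i : \sum_j phase_cost j i <= \sum_(t < n) cost t i.
Proof.
have fbound (jl : 'I_m * 'I_n) : (jl.1 + m * jl.2 < m + m * n)%N.
  by rewrite -addSn leq_add// leq_mul2l ltnW ?orbT.
pose f jl := Ordinal (fbound jl).
have fE jl : f jl = (jl.1 + m * jl.2)%N :> nat by [].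
have injf : injective f.
  move=> [j l] [j' l'] /(congr1 val) /= e.
  have ej : j = j' :> nat.
    by have := congr1 (modn^~ m) e; rewrite ![(_ + m * _)%N]addnC ![(m * _)%N]mulnC !modnMDl !modn_small.
  have el : l = l' :> nat.
    by move: e; rewrite ej => /addnI/eqP; rewrite eqn_mul2l eqn0Ngt m0 => /eqP.
  by congr pair; exact: val_inj.
rewrite (_ : \sum_j _ = \sum_(jl : 'I_m * 'I_n | (jl.2 < len jl.1)%N) cost (f jl) i).
  rewrite [leRHS](big_ord_widen (m + m * n) (fun t => cost t i))/=; last first.
    by rewrite (@leq_trans (m * n))%N ?leq_addl// leq_pmull.
  apply: (@ler_sum_inj _ _ _ f _ _ (fun t => cost t i)) => // -[j l]/= lL.
  by rewrite (leq_trans _ (block_bound _ lL))// -[X in (X < _)%N]addn0 ltn_add2l.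
rewrite -(pair_big_dep predT (fun (j : 'I_m) (l : 'I_n) => (l < len j)%N)
  (fun (j : 'I_m) (l : 'I_n) => cost (f (j, l)) i))/=.
apply: eq_bigr => j _; rewrite /phase_cost (big_ord_widen n (fun l => cost (j + m * l) i)).
  by apply: eq_bigr => l _.
by rewrite (leq_trans (leq_div _ _))// leq_subr.
Qed.

(** A word is recovered from its full blocks of phase [j] and two more, at 0 and after the last full
    one, which supply the incomplete ends. The two extra blocks account for the square; the sum over
    the full ones factors into powers of [\sum_w r w <= 1]. *)
Let sum_prod_block (j : 'I_m) :
  \sum_(i : n.-tuple 'I_N.+1) \prod_(l < len j) r (block (j + m * l) i) <=
  (N.+1 ^ m)%:R ^+ 2.
Proof.
pose J := (m.-tuple 'I_N.+1 * {ffun 'I_(len j) -> m.-tuple 'I_N.+1} * m.-tuple 'I_N.+1)%type.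
pose f (i : n.-tuple 'I_N.+1) : J :=
  (block 0 i, [ffun l : 'I_(len j) => block (j + m * l) i], block (j + m * len j) i).
have blockE t i i' k : block t i = block t i' -> (k < m)%N -> nth ord0 i (t + k) = nth ord0 i' (t + k).
  by move=> /wordP h km; have := h k km; rewrite !iter_shift.
have injf : injective f.
  move=> i i' /eqP; rewrite !xpair_eqE => /andP[/andP[/eqP e1 /eqP/ffunP e2] /eqP e3].
  apply: val_inj; apply: (@eq_from_nth _ ord0).
    by rewrite !size_tuple.
  move=> k; rewrite size_tuple => kn.
  have [km|mk] := ltnP k m; first exact: (blockE 0%N _ _ _ e1 km).
  have jk : (j <= k)%N by rewrite (leq_trans _ mk)// ltnW.
  rewrite -(subnKC jk) (divn_eq (k - j) m) mulnC addnA.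
  have kL : ((k - j) %/ m <= len j)%N by rewrite leq_div2r// leq_sub2r// ltnW.
  apply: blockE; rewrite ?ltn_pmod//.
  move: kL; rewrite leq_eqVlt => /predU1P[->//|kL].
  by have := e2 (Ordinal kL); rewrite !ffunE.
pose F (c : J) := \prod_l r (c.1.2 l).
have F0 c : 0 <= F c by apply: prodr_ge0 => l _; exact: ltW.
rewrite (@le_trans _ _ (\sum_c F c))//.
  rewrite (le_trans _ (ler_sum_inj (f := f) (P := predT) (Q := predT) injf _ F0))//.
  apply: ler_sum => i _; rewrite /F le_eqVlt; apply/orP; left; apply/eqP.
  by apply: eq_bigr => l _; rewrite ffunE.
have -> : \sum_c F c = \sum_(a : m.-tuple 'I_N.+1) \sum_(b : m.-tuple 'I_N.+1)
    \prod_(l < len j) \sum_w r w.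
  transitivity (\sum_a \sum_(x : {ffun 'I_(len j) -> m.-tuple 'I_N.+1})
      \sum_b F (a, x, b)).
    rewrite pair_bigA/= pair_bigA/=; apply: eq_bigr => -[[a x] b] _ //.
  apply: eq_bigr => a _; rewrite exchange_big/=; apply: eq_bigr => b _.
  by rewrite bigA_distr_bigA.
rewrite (@le_trans _ _ (\sum_(a : m.-tuple 'I_N.+1) \sum_(b : m.-tuple 'I_N.+1) 1))//.
  apply: ler_sum => a _; apply: ler_sum => b _; rewrite prodr_const.
  by rewrite exprn_ile1// sumr_ge0// => w _; exact: ltW.
by rewrite !sumr_const card_tuple card_ord -mulrnA expr2 -natrM.
Qed.

(** By averaging, some phase costs at most [D / m]. Then the product of [r] over its blocks is at
    least [expR (- (D / m))], and these products have a bounded sum over all words. The factor [m]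
    is the choice of the phase. *)
Lemma card_words_le (D : R) :
  #|[pred i : n.-tuple 'I_N.+1 | \sum_(t < n) cost t i <= D]|%:R <=
  m%:R * (N.+1 ^ m)%:R ^+ 2 * expR (D / m%:R).
Proof.
have m0' : 0 < m%:R :> R by rewrite ltr0n.
pose G j := [pred i : n.-tuple 'I_N.+1 | phase_cost j i <= D / m%:R].
have cardG j : #|G j|%:R <= (N.+1 ^ m)%:R ^+ 2 * expR (D / m%:R).
  rewrite -ler_pdivrMr ?expR_gt0// -expRN (le_trans _ (sum_prod_block j))//.
  set E := expR _.
  have -> : #|G j|%:R * E = \sum_(i | G j i) E by rewrite sumr_const mulr_natl.
  rewrite big_mkcond; apply: ler_sum => i _.
  case: ifPn => [Gi|_]; last by apply: prodr_ge0 => l _; exact: ltW.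
  rewrite (eq_bigr (fun l : 'I_(len j) => expR (- cost (j + m * l) i))); last first.
    by move=> l _; rewrite opprK lnK// posrE.
  by rewrite -expR_sum ler_expR sumrN lerN2.
rewrite (@le_trans _ _ (\sum_j #|G j|%:R))//; last first.
  rewrite (le_trans (ler_sum _ (fun j _ => cardG j)))// sumr_const card_ord.
  by rewrite -[leLHS]mulr_natl mulrA.
rewrite -natr_sum ler_nat.
have -> : \sum_j #|G j| = \sum_(j < m) \sum_(i : n.-tuple 'I_N.+1) (i \in G j : nat).
  by apply: eq_bigr => j _; rewrite -sum1_card big_mkcond.
rewrite exchange_big/= -sum1_card big_mkcond/=; apply: leq_sum => i _.
case: ifPn => //; rewrite inE => iD.
have [j Gj|nG] := pickP (fun j => i \in G j); first by rewrite (bigD1 j)//= Gj.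
exfalso; move: (le_trans (sum_phase_cost i) iD); apply/negP; rewrite -ltNge.
have -> : D = \sum_(j < m) D / m%:R.
  by rewrite sumr_const card_ord -[RHS]mulr_natr mulfVK ?gt_eqF.
apply: ltr_sum => [|j _]; last by rewrite ltNge; have := nG j; rewrite inE => ->.
by apply/hasP; exists (Ordinal m0); rewrite ?mem_index_enum.
Qed.

End cross_entropy_count.

(** * Topology and measures on strings *)

Lemma cvg_initial (S : choiceType) (T : topologicalType) (f : S -> T)
    (F : set_system S) (s : S) : Filter F ->
  f @ F --> f s -> F --> (s : initial_topology f).
Proof.
move=> FF cvf A /= [_ [[B Bop <-] Bs sBA]].
by apply: filterS sBA _; apply: cvf; exact: open_nbhs_nbhs.
Qed.

Lemma cvg_ptws (I : Type) (V : topologicalType) (F : set_system (I -> V))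
    (f : I -> V) : Filter F ->
  (forall t, (fun g => g t) @ F --> f t) -> F --> (f : {ptws I -> V}).
Proof. by move=> FF cvf; apply/cvg_sup => t; exact: cvg_initial. Qed.

Section strings_topology.
Variable N : nat.
Local Notation A := 'I_N.+1.
Implicit Types u v : strings N.

Lemma nbhs_word u k : nbhs u [set v | word k v = word k u].
Proof.
suff : nbhs u [set v | forall j, (j < k)%N -> v j = u j].
  by apply: filterS => v /= h; apply/wordP.
elim: k => [|k ih]; first exact: filterS filterT.
have uk : nbhs u [set v | v k = u k].
  apply: (@proj_continuous _ (fun _ : nat => discrete_topology A) k u [set a | a = u k]).
  by rewrite nbhs_principalE; apply/principal_filterP.
apply: filterS2 ih uk => v h1 h2 j; rewrite ltnS leq_eqVlt => /predU1P[->//|].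
exact: h1.
Qed.

(** The cylinders around [u] generate a filter that converges to [u] in each coordinate, hence in
    the product topology. *)
Lemma nbhs_words u (W : set (strings N)) : nbhs u W ->
  exists k, [set v | word k v = word k u] `<=` W.
Proof.
pose F : set_system (strings N) :=
  filter_from setT (fun k => [set v | word k v = word k u]).
have FF : Filter F.
  apply: filter_from_filter => [|j k _ _]; first by exists 0%N.
  exists (maxn j k) => // v /= uv.
  by split; apply: word_le uv; rewrite ?leq_maxl ?leq_maxr.
have Fu : F --> u.
  apply: cvg_ptws => t W'; rewrite nbhs_principalE => /principal_filterP W'u.
  by exists t.+1 => // v /= /wordP/(_ t (ltnSn _)) ->.
by move=> /Fu [k _ kW]; exists k.
Qed.

Lemma strings_compact : compact [set: strings N].
Proof.
have := @tychonoff nat (fun _ => discrete_topology A) (fun _ => setT).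
have -> : [set f : forall i : nat, discrete_topology A | forall i : nat, [set: discrete_topology A] (f i)] = setT.
  by apply/seteqP; split.
apply => _; apply: finite_compact; exact: finite_finset.
Qed.

Lemma open_cylinder k (P : set (k.-tuple A)) : open [set u : strings N | P (word k u)].
Proof.
rewrite openE => u /= Pu; apply: filterS (nbhs_word u k) => v /=.
by rewrite /interior /= => ->.
Qed.

Section continuous_functions.
Variables (R : realType) (g : strings N -> R).

(* Uniform continuity, by compactness. *)
Lemma continuous_word : continuous g -> forall e, 0 < e ->
  exists k, forall u v, word k u = word k v -> `|g u - g v| <= e.
Proof.
move=> cg e e0.
have e2 : 0 < e / 2 by rewrite divr_gt0.
have [k _ gk] : \forall k \near \oo, [set: strings N] `<=`
    (fun u => forall v, word k u = word k v -> `|g u - g v| <= e).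
  apply: (compact_near_coveringP _).1; first exact: strings_compact.
  move=> u _.
  have /nbhs_words[k uk] : nbhs u [set v | `|g u - g v| < e / 2].
    by move/cvgrPdist_lt : (cg u) => /(_ _ e2).
  exists ([set v | word k v = word k u], [set j | (k <= j)%N]).
    by split=> /=; [exact: nbhs_word | exists k].
  move=> [u' j] [/= u'u kj] v u'v.
  have h1 := uk _ u'u.
  have h2 : `|g u - g v| < e / 2.
    by apply: uk => /=; rewrite -u'u; apply/esym; exact: word_le u'v.
  rewrite -(subrKA (g u)) (le_trans (ler_normD _ _))//.
  by rewrite [leRHS]splitr distrC lerD// ltW.
by exists k => u v; apply: gk => /=.
Qed.

Lemma word_continuous : (forall e, 0 < e ->
  exists k, forall u v, word k u = word k v -> `|g u - g v| <= e) -> continuous g.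
Proof.
move=> lg u; apply/(@cvgrPdist_le _ _ _ (nbhs u)) => e /lg[k gk].
by apply: filterS (nbhs_word u k) => v /= uv; apply: gk.
Qed.

Lemma continuous_bounded : continuous g -> exists M, forall u, `|g u| <= M.
Proof.
move=> /continuous_word/(_ _ ltr01)[k gk].
exists (1 + \sum_(w : k.-tuple A) `|g (padded w)|) => u.
rewrite -(subrK (g (padded (word k u))) (g u)) (le_trans (ler_normD _ _))// lerD//.
  by apply: gk; rewrite word_padded.
by rewrite (bigD1 (word k u))//= lerDl sumr_ge0.
Qed.

End continuous_functions.

Lemma indicator_continuous (R : realType) k (w : k.-tuple A) :
  continuous (fun u : strings N => (word k u == w)%:R : R).
Proof.
by apply: word_continuous => e e0; exists k => u v ->; rewrite subrr normr0 ltW.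
Qed.

End strings_topology.

(** * Borel sets of strings and word laws *)

Section strings_measure.
Variables (R : realType) (N : nat).
Local Notation A := 'I_N.+1.
Implicit Types (u v : strings N) (mu nu : probability (borel_strings N) R).

Lemma label_word k : label (word k : borel_strings N -> k.-tuple A).
Proof. by move=> w; apply: sub_sigma_algebra; exact: (open_cylinder [set w]). Qed.

Lemma label_factor (I : finType) k (X : strings N -> I) :
    (forall u v, word k u = word k v -> X u = X v) ->
  label (X : borel_strings N -> I).
Proof.
move=> Xk.
rewrite (_ : X = (fun w : k.-tuple A => X (padded w)) \o (word k : borel_strings N -> _)).
  by apply: label_comp; exact: label_word.
by apply/funext => u; apply: Xk; exact/esym/word_padded.
Qed.

(* Open sets are unions of countably many cylinders. *)
Lemma borel_strings_min (G : set_system (strings N)) :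
    sigma_algebra setT G ->
    (forall k (w : k.-tuple A), G [set u | word k u = w]) ->
  forall B : set (borel_strings N), measurable B -> G B.
Proof.
move=> sG Gcyl B; apply: smallest_sub => // O oO.
pose cyl (s : seq A) : set (strings N) :=
  [set u | forall j, (j < size s)%N -> u j = nth ord0 s j].
have Gcyl' s : G (cyl s).
  rewrite (_ : cyl s = [set u | word (size s) u = in_tuple s])//.
  by apply/seteqP; split => u; rewrite /cyl /= word_eqP.
(* Finite words are enumerated by [pickle]; a code counts only if its cylinder lies in [O]. *)
pose F n := if unpickle n is Some s then
  if `[< cyl s `<=` O >] then cyl s else set0 else set0.
have [G0 _ Gcup] := sG.
have -> : O = \bigcup_n F n.
  apply/seteqP; split => [u Ou|u [n _]]; last first.
    by rewrite /F; case: unpickle => [s|[]]; case: ifPn => [/asboolP sO /sO|_ []].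
  have [k kO] := nbhs_words (open_nbhs_nbhs (conj oO Ou)).
  have cylO : cyl (word k u) `<=` O.
    by move=> v uv; apply: kO; apply/word_eqP => j jk; apply: uv; rewrite size_tuple.
  exists (pickle (word k u : seq A)) => //; rewrite /F pickleK; move/asboolP: cylO => ->.
  by move=> j; rewrite size_tuple => jk; apply/word_eqP: j jk.
by apply: Gcup => n; rewrite /F; case: unpickle => // s; case: ifPn.
Qed.

Lemma continuous_measurable_strings (g : strings N -> R) : continuous g ->
  measurable_fun [set: borel_strings N] (g : borel_strings N -> R).
Proof.
move=> /continuousP cg; apply: (measurability _ (measurable_realfun.RGenOpens.measurableE R)).
move=> _ [_ [a [b ->] <-]]; rewrite setTI; apply: sub_sigma_algebra.
exact/cg/interval_open.
Qed.

Lemma continuous_integrable_strings mu (g : strings N -> R) : continuous g ->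
  mu.-integrable setT (EFin \o (g : borel_strings N -> R)).
Proof.
move=> cg; apply: measurable_bounded_integrable => //.
- by rewrite (le_lt_trans (probability_le1 _ _))// ltry.
- exact: continuous_measurable_strings.
have [M gM] := continuous_bounded cg; exists M; split; first exact: num_real.
by move=> x /ltW Mx u _; exact: le_trans (gM u) Mx.
Qed.

Lemma Rintegral_label mu (I : finType) (X : borel_strings N -> I) (F : I -> R) :
  label X -> \int[mu]_u F (X u) = \sum_a F a * law mu X a.
Proof.
move=> mX; rewrite /Rintegral.
rewrite (eq_integral (fun x => \sum_a (F a)%:E * (\1_(X @^-1` [set a]) x)%:E)%E); last first.
  move=> x _; rewrite (bigD1 (X x))//= indicE mem_set//= mule1 big1 ?adde0// => a aX.
  by rewrite indicE memNset ?mule0//= => aE; rewrite aE eqxx in aX.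
have iX a : mu.-integrable setT (fun x => (F a)%:E * (\1_(X @^-1` [set a]) x)%:E)%E.
  apply: integrableZl => //; apply: integrable_indic; exact: mX.
rewrite integral_sum//.
rewrite (eq_bigr (fun a => (F a * law mu X a)%:E)); last first.
  move=> a _; rewrite integralZl//; last first.
    by apply: integrable_indic; exact: mX.
  have mXa := mX a.
  by rewrite integral_indic// setIT EFinM fineK// fin_num_measure.
by rewrite sumEFin.
Qed.

Definition word_law mu k (w : k.-tuple A) : R :=
  law mu (word k : borel_strings N -> k.-tuple A) w.

(** Replacing [g u] by its value at the padded prefix of [u] changes it by at most [e]. This reduces
    the weak topology to word laws. *)
Lemma Rintegral_word mu (g : strings N -> R) k (e : R) : continuous g ->
    (forall u v, word k u = word k v -> `|g u - g v| <= e) ->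
  `|\int[mu]_u g u - \sum_(w : k.-tuple A) g (padded w) * word_law mu w| <= e.
Proof.
move=> cg gk; rewrite -(Rintegral_label mu (fun w : k.-tuple A => g (padded w)) (@label_word k)).
have ch : continuous (fun u : strings N => g (padded (word k u))).
  apply: word_continuous => e' e'0; exists k => u v ->.
  by rewrite subrr normr0 ltW.
have ce : continuous (fun _ : strings N => e).
  by apply: word_continuous => e' e'0; exists 0%N => u v _; rewrite subrr normr0 ltW.
have e0 : 0 <= e by rewrite (le_trans _ (gk point point erefl)).
rewrite -RintegralB//; last 2 first.
- exact: (continuous_integrable_strings _ cg).
- exact: (continuous_integrable_strings _ ch).
have cd : continuous (fun u => g u - g (padded (word k u))).
  apply: word_continuous => e' /(continuous_word cg)[j gj].
  exists (maxn j k) => u v uv; rewrite (word_le (leq_maxr j k) uv).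
  by rewrite opprB addrA subrK gj// (word_le (leq_maxl j k) uv).
have cn : continuous (fun u => `|g u - g (padded (word k u))|).
  apply: word_continuous => e' /(continuous_word cd)[j gj].
  by exists j => u v /gj; apply: le_trans; exact: ler_dist_dist.
apply: (le_trans (le_normr_Rintegral _ (continuous_integrable_strings _ cd))) => //.
rewrite (@le_trans _ _ (\int[mu]_u e))//.
  apply: le_Rintegral => //; last by move=> u _; apply: gk; rewrite word_padded.
    exact: (continuous_integrable_strings _ cn).
  exact: (continuous_integrable_strings _ ce).
rewrite Rintegral_cst//.
have -> : fine (mu setT) = 1 by rewrite probability_setT.
by rewrite mulr1.
Qed.

End strings_measure.

(** * Empirical measures and the weak topology *)

Section empirical_measures.
Variables (R : realType) (N : nat).
Local Notation A := 'I_N.+1.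
Implicit Types (u v : strings N) (mu nu : probability (borel_strings N) R).
Local Notation S := (@shift_map N).

(** Two cylinders are nested or disjoint, so together with the empty set they are stable under
    intersection, and they generate the Borel sets. *)
Lemma word_measure_unique (m1 m2 : {measure set (borel_strings N) -> \bar R}) :
    (forall k (w : k.-tuple A), m1 [set u | word k u = w] = m2 [set u | word k u = w]) ->
    (m1 setT < +oo)%E ->
  forall B, measurable B -> m1 B = m2 B.
Proof.
move=> m12 m1fin.
pose G : set_system (borel_strings N) :=
  [set B | B = set0 \/ exists k (w : k.-tuple A), B = [set u | word k u = w]].
have cylT : [set u : borel_strings N | word 0 u = [tuple]] = setT.
  by apply/seteqP; split => // u _ /=; exact: tuple0.
apply: (measure_unique G (fun=> setT)) => //.
- apply/seteqP; split; last first.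
    apply: smallest_sub; first exact: sigma_algebra_measurable.
    by move=> _ [->|[k [w ->]]]; [exact: measurable0 | exact: label_word].
  apply: borel_strings_min; first exact: smallest_sigma_algebra.
  by move=> k w; apply: sub_sigma_algebra; right; exists k, w.
- have key j k (v : j.-tuple A) (w : k.-tuple A) : (j <= k)%N ->
      G ([set u | word j u = v] `&` [set u | word k u = w]).
    move=> jk; have [vw|vw] := eqVneq (word j (padded w)) v; last first.
      left; apply/seteqP; split => // u [/= uv uw]; case/eqP: vw.
      by rewrite -uv; apply: (word_le jk); rewrite word_padded uw.
    right; exists k, w; apply/seteqP; split => [u []//|u /= uw]; split => //=.
    by rewrite -vw; apply: (word_le jk); rewrite word_padded uw.
  move=> B C [->|[j [v ->]]]; first by rewrite set0I; left.
  move=> [->|[k [w ->]]]; first by rewrite setI0; left.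
  by case/orP: (leq_total j k) => ?; [|rewrite setIC]; exact: key.
- by move=> _; right; exists 0%N, [tuple].
- by rewrite bigcup_const.
- by move=> _ [->|[k [w ->]]]; rewrite ?measure0.
Qed.

Lemma measurable_shift : measurable_fun [set: borel_strings N] (S : borel_strings N -> borel_strings N).
Proof.
move=> _ B; rewrite setTI; move: B.
apply: (@borel_strings_min N (fun B : set (borel_strings N) => measurable (S @^-1` B : set (borel_strings N)))).
  split => [|B mB|F mF].
  - by rewrite preimage_set0.
  - by rewrite setTD preimage_setC; exact: measurableC.
  - by rewrite preimage_bigcup; exact: bigcup_measurable.
move=> k w.
have : label ((fun u => word k (S u)) : borel_strings N -> k.-tuple A).
  apply: (@label_factor _ _ k.+1) => u v uv.
  by apply: (@word_shift _ 1); rewrite add1n.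
by move/(_ w).
Qed.

Lemma invariant_word mu :
  (forall k (w : k.-tuple A), mu (S @^-1` [set u | word k u = w]) = mu [set u | word k u = w]) ->
  invariant_measure mu S.
Proof.
move=> muS B mB.
pose f : {mfun borel_strings N >-> borel_strings N} :=
  HB.pack (S : borel_strings N -> borel_strings N)
    (isMeasurableFun.Build _ _ _ _ _ measurable_shift).
apply: (@word_measure_unique (distribution mu f) mu) => //.
by rewrite /= /distribution /pushforward preimage_setT probability_setT ltry.
Qed.

Lemma law_empirical n u (I : finType) (X : borel_strings N -> I) a :
  law (empirical R n.+1 u) X a = n.+1%:R^-1 * \sum_(t < n.+1) (X (iter t S u) == a)%:R.
Proof.
rewrite /law /= /orbit_average /mscale /= /msum.
rewrite (eq_bigr (fun t : 'I_n.+1 => ((X (iter t S u) == a)%:R%:E : \bar R))); last first.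
  move=> t _; transitivity ((\1_(X @^-1` [set a]) (iter t S u : borel_strings N))%:E : \bar R) => //.
  rewrite indicE; congr ((nat_of_bool _)%:R%:E).
  by apply/idP/idP => [/set_mem/eqP//|/eqP h]; apply/mem_set.
by rewrite sumEFin.
Qed.

Lemma birkhoff_empirical n u k (e : R) (g : strings N -> R) :
    (forall u v, word k u = word k v -> `|g u - g v| <= e) ->
  `|n.+1%:R^-1 * birkhoff_sum g n.+1 u -
     \sum_(w : k.-tuple A) g (padded w) * word_law (empirical R n.+1 u) w| <= e.
Proof.
move=> gk; have n0 : 0 < n.+1%:R :> R by rewrite ltr0n.
have -> : \sum_(w : k.-tuple A) g (padded w) * word_law (empirical R n.+1 u) w =
    n.+1%:R^-1 * \sum_(t < n.+1) g (padded (word k (iter t S u))).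
  under eq_bigr do rewrite /word_law law_empirical mulrCA.
  rewrite -mulr_sumr; congr (_ * _).
  under eq_bigr do rewrite mulr_sumr.
  rewrite exchange_big/=; apply: eq_bigr => t _.
  rewrite (bigD1 (word k (iter t S u)))//= eqxx mulr1 big1 ?addr0// => w.
  by rewrite eq_sym => /negbTE ->; rewrite mulr0.
rewrite -mulrBr normrM normfV (ger0_norm (ltW n0)) ler_pdivrMl//.
rewrite /birkhoff_sum -sumrB (le_trans (ler_norm_sum _ _ _))//.
have -> : n.+1%:R * e = \sum_(t < n.+1) e by rewrite sumr_const card_ord mulr_natl.
apply: ler_sum => t _.
by apply: gk; rewrite word_padded.
Qed.

(** Both sides are within [e / 2] of the same sum over words, for every [e]; no integral against a
    sum of Dirac measures is computed. *)
Lemma Rintegral_empirical n u (g : strings N -> R) : continuous g ->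
  \int[empirical R n.+1 u]_v g v = n.+1%:R^-1 * birkhoff_sum g n.+1 u.
Proof.
move=> cg; apply/eqP; rewrite -subr_eq0 -normr_le0; apply/ler_addgt0Pl => e e0.
have e2 : 0 < e / 2 by rewrite divr_gt0.
have [k gk] := continuous_word cg e2.
have h1 := @Rintegral_word _ _ (empirical R n.+1 u) g k _ cg gk.
have h2 := @birkhoff_empirical n u k _ g gk.
rewrite addr0 -(subrKA (\sum_(w : k.-tuple A) g (padded w) * word_law (empirical R n.+1 u) w)).
by rewrite [leRHS]splitr (le_trans (ler_normD _ _))// lerD// distrC.
Qed.

Definition word_close k (e : R) (mu nu : probability (borel_strings N) R) :=
  forall j (w : j.-tuple A), (j <= k)%N -> `|word_law nu w - word_law mu w| <= e.

Lemma Rintegral_close mu (g : strings N -> R) e : continuous g -> 0 < e ->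
  exists k d, 0 < d /\ forall nu, word_close k d mu nu ->
    `|\int[nu]_u g u - \int[mu]_u g u| <= e.
Proof.
move=> cg e0; have e4 : 0 < e / 4 by rewrite divr_gt0.
have [k gk] := continuous_word cg e4.
pose M := 1 + \sum_(w : k.-tuple A) `|g (padded w)|.
have M0 : 0 < M by rewrite ltr_pwDl// sumr_ge0.
exists k, (e / 2 / M); split; first by rewrite !divr_gt0.
move=> nu close.
have h1 := @Rintegral_word _ _ mu g k _ cg gk.
have h2 := @Rintegral_word _ _ nu g k _ cg gk.
have h3 : `|\sum_(w : k.-tuple A) g (padded w) * word_law nu w - \sum_(w : k.-tuple A) g (padded w) * word_law mu w| <= e / 2.
  rewrite -sumrB (le_trans (ler_norm_sum _ _ _))//.
  rewrite (@le_trans _ _ (\sum_(w : k.-tuple A) `|g (padded w)| * (e / 2 / M)))//.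
    by apply: ler_sum => w _; rewrite -mulrBr normrM ler_wpM2l// close.
  rewrite -mulr_suml mulrA ler_pdivrMr// mulrC ler_wpM2l ?divr_ge0 ?ltW//.
  by rewrite /M ltrDr.
move: h1 h2 h3; rewrite !ler_norml; lra.
Qed.

(** The sets [word_close k d mu] generate a filter that converges weakly to [mu]: the integral of a
    continuous function is controlled by finitely many word laws. *)
Lemma weak_continuous_close (X : topologicalType) (U : weak_probability R N -> X)
    mu (B : set X) : continuous U -> nbhs (U mu) B ->
  exists k d, 0 < d /\ forall nu, word_close k d mu nu -> B (U nu).
Proof.
move=> cU nB.
pose F : set_system (weak_probability R N) :=
  filter_from [set kd : nat * R | 0 < kd.2] (fun kd => word_close kd.1 kd.2 mu).
have FF : Filter F.
  apply: filter_from_filter => [|[k d] [k' d'] /= d0 d'0]; first by exists (0%N, 1) => /=.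
  exists (maxn k k', Num.min d d') => /=; first by rewrite lt_min d0.
  move=> nu close; split => j w jk.
    by rewrite (le_trans (close _ _ _)) ?ge_min ?lexx// (leq_trans jk) ?leq_maxl.
  by rewrite (le_trans (close _ _ _)) ?ge_min ?lexx ?orbT// (leq_trans jk) ?leq_maxr.
have Fmu : F --> (mu : weak_probability R N).
  apply: cvg_initial; apply: cvg_ptws => -[g cg] /=.
  apply/cvgrPdist_le => e e0.
  have [k [d [d0 close]]] := Rintegral_close mu cg e0.
  by exists (k, d) => //= nu /close; rewrite distrC.
have [[k d] /= d0 kd] : F (U @^-1` B) by apply: Fmu; exact: cU.
by exists k, d.
Qed.

End empirical_measures.

(** * The Kolmogorov-Sinai theorem for the full shift *)

Section itineraries.
Context d (T : measurableType d) (R : realType).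
Variables (mu : probability T R) (f : T -> T).
Hypotheses (mf : measurable_fun setT f) (muf : invariant_measure mu f).
Implicit Types I : finType.

Definition itinerary I (xi : T -> I) n (x : T) : n.-tuple I :=
  [tuple xi (iter j f x) | j < n].

Lemma label_iter I (xi : T -> I) n : label xi ->
  label (xi \o iter n f) /\ law mu (xi \o iter n f) = law mu xi.
Proof.
move=> mxi; elim: n => [|n [mn ih]]; first by [].
have e a : (xi \o iter n.+1 f) @^-1` [set a] = f @^-1` ((xi \o iter n f) @^-1` [set a]).
  by apply/seteqP; split => x /=; rewrite -iterS iterSr.
split; first by move=> a; rewrite e -[X in measurable X]setTI; apply: mf => //; exact: mn.
by rewrite -ih; apply/funext => a; rewrite /law e muf//; exact: mn.
Qed.

Lemma label_itinerary I (xi : T -> I) n : label xi -> label (itinerary xi n).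
Proof.
move=> mxi w.
rewrite (_ : _ @^-1` _ = \bigcap_(j in [set: 'I_n]) ((xi \o iter j f) @^-1` [set tnth w j])).
  apply: fin_bigcap_measurable; first exact: finite_finset.
  by move=> j _; exact: (label_iter j mxi).1.
apply/seteqP; split => [x /= <- j _ /=|x /= xw]; first by rewrite tnth_mktuple.
by apply: eq_from_tnth => j; rewrite tnth_mktuple; exact: xw.
Qed.

Lemma join_entropyE k (xi : T -> 'I_k) n :
  join_entropy mu f xi n = shannon mu (itinerary xi n).
Proof.
apply: eq_bigr => w _; rewrite /eta /law.
rewrite (_ : join_atom f xi w = itinerary xi n @^-1` [set w])//.
apply/seteqP; split => [x /= xw|x /= <- j]; last by rewrite tnth_mktuple.
by apply: eq_from_tnth => j; rewrite tnth_mktuple.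
Qed.

(** By invariance the itinerary from time [m] on has the same law as the one from time 0, and the
    two pieces determine the whole. *)
Lemma shannon_itineraryD I (xi : T -> I) m n : label xi ->
  shannon mu (itinerary xi (m + n)) <=
  shannon mu (itinerary xi m) + shannon mu (itinerary xi n).
Proof.
move=> mxi; have [lm ln] := label_iter m (label_itinerary (n := n) mxi).
have -> : shannon mu (itinerary xi n) = shannon mu (itinerary xi n \o iter m f).
  by rewrite /shannon ln.
apply: le_trans (shannon_pair mu (label_itinerary (n := m) mxi) lm).
rewrite (_ : itinerary xi (m + n) =
  (fun c : m.-tuple I * n.-tuple I => [tuple of c.1 ++ c.2]) \o
  (fun x => (itinerary xi m x, (itinerary xi n \o iter m f) x))).
  by apply: shannon_comp; apply: label_pair => //; exact: label_itinerary.
apply/funext => x /=; apply: eq_from_tnth => j; rewrite tnth_mktuple.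
case: (split_ordP j) => i ->.
  by rewrite tnth_lshift tnth_mktuple.
by rewrite tnth_rshift tnth_mktuple/= -iterD addnC.
Qed.

Lemma shannon_itinerary_le I (xi : T -> I) n : label xi ->
  shannon mu (itinerary xi n) <= n%:R * shannon mu xi.
Proof.
move=> mxi; case: n => [|n].
  rewrite mul0r /shannon big1// => w _.
  suff -> : law mu (itinerary xi 0) w = 1 by rewrite /eta ln1 mulr0 oppr0.
  rewrite /law (_ : _ @^-1` _ = setT) ?probability_setT//.
  by apply/seteqP; split => // x _ /=; rewrite [w]tuple0; exact: tuple0.
rewrite -[n.+1 in leLHS]mul1n.
rewrite (le_trans (@subadditive_mul_le _ (fun n => shannon mu (itinerary xi n)) _ _ _))//.
  by move=> *; exact: shannon_itineraryD.
rewrite ler_wpM2l//.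
rewrite (_ : itinerary xi 1 = (fun a => [tuple a]) \o xi); first exact: shannon_comp.
by apply/funext => x; apply: eq_from_tnth => j; rewrite tnth_mktuple (tnth_nth (xi x)) ord1.
Qed.

Lemma partition_entropy_cvg k (xi : T -> 'I_k) : label xi ->
  (n%:R^-1 * shannon mu (itinerary xi n) @[n --> \oo] --> partition_entropy mu f xi) /\
  forall n, (0 < n)%N -> partition_entropy mu f xi <= n%:R^-1 * shannon mu (itinerary xi n).
Proof.
move=> mxi; pose a n := shannon mu (itinerary xi n).
have [ca la] : _ := @fekete _ a
   (fun n => shannon_ge0 mu (label_itinerary (n := n) mxi)) (fun m n => shannon_itineraryD m n mxi).
have -> : partition_entropy mu f xi = limn (fun n => n%:R^-1 * a n).
  by rewrite /partition_entropy; under eq_fun do rewrite join_entropyE.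
by split.
Qed.

End itineraries.

Section small_entropy.
Context d (T : measurableType d) (R : realType).
Variables (mu : probability T R).

(* [X] is the error label of an approximation of a partition; [None] means no
   error. *)
Lemma shannon_option (I : finType) (X : T -> option I) (c : R) : label X ->
    0 <= c <= 1 -> 1 - law mu X None <= c ^+ 2 ->
  shannon mu X <= (1 + 2 * #|I|%:R) * c.
Proof.
move=> mX /andP[c0 c1] XN.
have tot : \sum_a law mu X a = law mu X None + \sum_(i : I) law mu X (Some i).
  rewrite (bigD1 None)//=; congr (_ + _).
  rewrite (reindex_omap Some id)/=; last by case.
  by apply: eq_bigl => i; rewrite eqxx.
have XS i : law mu X (Some i) <= c ^+ 2.
  rewrite (le_trans _ XN)// lerBrDl -(law_sum1 mu mX) tot lerD2l (bigD1 i)//= lerDl.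
  by apply: sumr_ge0 => j _; exact: law_ge0.
rewrite /shannon (bigD1 None)//= mulrDl mul1r lerD//.
  rewrite (le_trans (eta_le_oneB (law_ge0 _ _ _)))// (le_trans XN)//.
  by rewrite expr2 -[leRHS]mulr1 ler_wpM2l.
rewrite (@le_trans _ _ (\sum_(i : I) 2 * c))//.
  have -> : \sum_(a | a != None) eta (law mu X a) = \sum_(i : I) eta (law mu X (Some i)).
    rewrite (reindex_omap Some id)/=; last by case.
    by apply: eq_bigl => i; rewrite eqxx.
  apply: ler_sum => i _; rewrite (le_trans (eta_le_sqrt (law_ge0 _ _ _)))//.
  rewrite ler_wpM2l//.
  by rewrite -[c]ger0_norm// -sqrtr_sqr ler_wsqrtr.
by rewrite sumr_const -mulr_natl; lra.
Qed.

End small_entropy.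

(** * Approximation of partitions by cylinders *)

Section generator.
Variables (R : realType) (N : nat).
Local Notation A := 'I_N.+1.
Local Notation S := (@shift_map N : borel_strings N -> borel_strings N).
Variable mu : probability (borel_strings N) R.
Implicit Types B C : set (borel_strings N).

(** [C] is a union of cylinders of length [j], in a form for which unions and complements are
    immediate. *)
Definition determined j C : Prop :=
  forall u v : strings N, word j u = word j v -> C u -> C v.

Lemma determined_le j k C : (j <= k)%N -> determined j C -> determined k C.
Proof. by move=> jk dC u v uv; apply: dC; exact: word_le uv. Qed.

Lemma determined_measurable j C : determined j C -> measurable C.
Proof.
move=> dC; pose X (u : strings N) := `[< C u >].
have mX : label (X : borel_strings N -> bool).
  apply: (@label_factor _ _ j) => u v uv; apply/asboolP/asboolP; exact: dC.
rewrite (_ : C = X @^-1` [set true]); first exact: mX.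
by apply/seteqP; split => u /= /asboolP.
Qed.

Definition symdiff B C : set (borel_strings N) := (B `\` C) `|` (C `\` B).

Definition approximable B : Prop := measurable B /\
  forall e : R, 0 < e -> exists j C, determined j C /\ fine (mu (symdiff B C)) <= e.

Let fine_le B C : measurable B -> measurable C -> B `<=` C -> fine (mu B) <= fine (mu C).
Proof.
by move=> mB mC BC; apply: fine_le; rewrite ?fin_num_measure// le_measure ?inE.
Qed.

Let fine_leU B C : measurable B -> measurable C ->
  fine (mu (B `|` C)) <= fine (mu B) + fine (mu C).
Proof.
move=> mB mC; rewrite -lee_fin EFinD !fineK ?fin_num_measure//; last exact: measurableU.
exact: measureU2.
Qed.

Let fine_le_bigU (I : finType) (F : I -> set (borel_strings N)) :
    (forall i, measurable (F i)) ->
  measurable (\big[setU/set0]_i F i) /\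
  fine (mu (\big[setU/set0]_i F i)) <= \sum_i fine (mu (F i)).
Proof.
move=> mF; apply: (big_ind2 (fun B x => measurable B /\ fine (mu B) <= x)) => //.
  by rewrite measure0.
move=> B x C y [mB Bx] [mC Cy]; split; first exact: measurableU.
by rewrite (le_trans (fine_leU mB mC))// lerD.
Qed.

Let measurable_symdiff B C : measurable B -> measurable C -> measurable (symdiff B C).
Proof. by move=> mB mC; apply: measurableU; exact: measurableD. Qed.

Let approximable_trans B : measurable B ->
  (forall e : R, 0 < e -> exists C, approximable C /\ fine (mu (symdiff B C)) <= e) ->
  approximable B.
Proof.
move=> mB h; split => // e e0; have e2 : 0 < e / 2 by rewrite divr_gt0.
have [C [[mC aC] BC]] := h _ e2; have [j [D [dD CD]]] := aC _ e2.
have mD := determined_measurable dD.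
exists j, D; split => //; rewrite [leRHS]splitr (le_trans _ (lerD BC CD))//.
rewrite (le_trans _ (fine_leU _ _))//; try exact: measurable_symdiff.
apply: fine_le; [exact: measurable_symdiff|apply: measurableU; exact: measurable_symdiff|].
move=> u [[Bu Du]|[Du Bu]]; have [Cu|Cu] := pselect (C u).
- by right; left.
- by left; left.
- by left; right.
- by right; right.
Qed.

Let approximableC B : approximable B -> approximable (~` B).
Proof.
move=> [mB aB]; split; first exact: measurableC.
move=> e /aB[j [C [dC BC]]]; exists j, (~` C); split.
  by move=> u v uv Cu Cv; apply: Cu; apply: dC Cv.
suff -> : symdiff (~` B) (~` C) = symdiff B C by [].
by rewrite /symdiff !setDE !setCK setUC setIC [X in _ `|` X]setIC.
Qed.

Let approximableU B B' : approximable B -> approximable B' -> approximable (B `|` B').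
Proof.
move=> [mB aB] [mB' aB']; split; first exact: measurableU.
move=> e e0; have e2 : 0 < e / 2 by rewrite divr_gt0.
have [j [C [dC BC]]] := aB _ e2; have [j' [C' [dC' BC']]] := aB' _ e2.
have mC := determined_measurable dC; have mC' := determined_measurable dC'.
exists (maxn j j'), (C `|` C'); split.
  move=> u v uv [Cu|Cu]; [left|right].
    exact: (determined_le (leq_maxl j j') dC) Cu.
  exact: (determined_le (leq_maxr j j') dC') Cu.
rewrite [leRHS]splitr (le_trans _ (lerD BC BC'))//.
rewrite (le_trans _ (fine_leU _ _))//; try exact: measurable_symdiff.
apply: fine_le.
- by apply: measurable_symdiff; exact: measurableU.
- by apply: measurableU; exact: measurable_symdiff.
move=> u [[[Bu|Bu] /not_orP[Cu Cu']]|[[Cu|Cu] /not_orP[Bu Bu']]].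
- by left; left.
- by right; left.
- by left; right.
- by right; right.
Qed.

(** Approximable sets contain the cylinders and form a sigma-algebra: a countable union exceeds its
    finite subunions by sets that decrease to the empty set. *)
Lemma measurable_approximable B : measurable B -> approximable B.
Proof.
move: B; apply: borel_strings_min; last first.
  move=> k w; split; first exact: label_word.
  move=> e e0; exists k, [set u | word k u = w]; split; first by move=> u v /= ->.
  by rewrite /symdiff setDv setU0 measure0 ltW.
have a0 : approximable set0.
  split => // e e0; exists 0%N, set0; split => //.
  by rewrite /symdiff setDv setU0 measure0 ltW.
split=> // [B|F' aF]; first by rewrite setTD; exact: approximableC.
pose F : nat -> set (borel_strings N) := F'; rewrite -/F.
have mF n : measurable (F n) := (aF n).1.
have mUF : measurable (\bigcup_n F n) by exact: bigcup_measurable.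
apply: (approximable_trans mUF) => e e0.
pose H n := \big[setU/set0]_(i < n) F i.
have aH n : approximable (H n).
  by elim: n => [|n ih]; rewrite /H ?big_ord0// big_ord_recr; exact: approximableU.
pose K n := (\bigcup_n F n) `\` H n.
have mK n : measurable (K n) by apply: measurableD => //; exact: (aH n).1.
have HF n : H n `<=` \bigcup_n F n by rewrite /H -bigcup_mkord; apply: bigcup_sub => i _; exact: bigcup_sup.
have K0 : \bigcap_n K n = set0.
  apply/seteqP; split => // u Ku; have [[n _ Fu] _] := Ku 0%N I.
  have [_] := Ku n.+1 I; apply; rewrite /H big_ord_recr; right; exact: Fu.
have : mu (K n) @[n --> \oo] --> mu (\bigcap_n K n).
  apply: nonincreasing_cvg_mu => //.
  - by rewrite (le_lt_trans (probability_le1 _ _))// ltry.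
  - exact: bigcap_measurable.
  move=> m n mn; apply/subsetPset; apply: setDS.
  by rewrite /H; apply: subset_bigsetU.
rewrite K0 measure0 => /fine_cvgP[_ /cvgrPdist_le/(_ _ e0)[n _ Kn]].
exists (H n); split => //.
rewrite /symdiff (_ : H n `\` _ = set0) ?setU0; last by rewrite setD_eq0; exact: HF.
by have := Kn n (leqnn n); rewrite sub0r normrN => /(le_trans (ler_norm _)).
Qed.

Hypothesis muS : invariant_measure mu S.

(** [xi] is replaced by [xi'], a function of the first [j] letters that rarely differs from it. The
    itinerary of [xi] is recovered from that of [xi'], a function of [j + n] letters, and from the
    corrections, whose entropy is at most [e] per step. *)
Lemma shannon_itinerary_word k (xi : borel_strings N -> 'I_k) (e : R) :
    label xi -> 0 < e ->
  exists j, forall n, shannon mu (itinerary S xi n) <=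
    shannon mu (word (j + n) : borel_strings N -> _) + n%:R * e.
Proof.
move=> mxi e0; case: k xi mxi => [xi|k xi mxi]; first by case: (xi point).
(* Chosen so that the bound of [shannon_option] for an error probability at most [c ^+ 2] is at most
   [e]; this error is shared among the [k.+1] atoms. *)
pose c := Num.min 1 (e / (1 + 2 * k.+1%:R)).
have c0 : 0 < c by rewrite lt_min ltr01 divr_gt0// ltr_pwDl.
have c1 : c <= 1 by rewrite ge_min lexx.
have ce : (1 + 2 * k.+1%:R) * c <= e.
  by rewrite mulrC -ler_pdivlMr ?ltr_pwDl// ge_min lexx orbT.
have dlt : 0 < c ^+ 2 / k.+1%:R by rewrite divr_gt0 ?exprn_gt0.
have /choice[jC jCP] : forall i, exists jC : nat * set (borel_strings N),
    determined jC.1 jC.2 /\ fine (mu (symdiff (xi @^-1` [set i]) jC.2)) <= c ^+ 2 / k.+1%:R.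
  move=> i; have [_ /(_ _ dlt)[j [C h]]] := measurable_approximable (mxi i).
  by exists (j, C).
pose j := \max_i (jC i).1.
(* The approximating sets need not form a partition; a point in none or several of them gets some
   label, and it lies in one of the symmetric differences. *)
pose xi' (u : strings N) : 'I_k.+1 := odflt ord0 [pick i | `[< (jC i).2 u >]].
have xi'j u v : word j u = word j v -> xi' u = xi' v.
  move=> uv; rewrite /xi'; congr odflt; apply: eq_pick => i.
  have ji : ((jC i).1 <= j)%N by rewrite /j (bigD1 i)//= leq_maxl.
  have dj := determined_le ji (jCP i).1.
  by apply/asboolP/asboolP; exact: dj.
have mxi' : label (xi' : borel_strings N -> _) by exact: label_factor xi'j.
pose E u := if xi u == xi' u then None else Some (xi u).
have mE : label E.
  rewrite (_ : E = (fun c => if c.1 == c.2 then None else Some c.1) \o (fun u => (xi u, xi' u)))//.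
  by apply: label_comp; exact: label_pair.
have bad : [set u | xi u != xi' u] `<=` \big[setU/set0]_i symdiff (xi @^-1` [set i]) (jC i).2.
  move=> u /= xu; apply: contrapT => nu.
  have {}nu i : ~ symdiff (xi @^-1` [set i]) (jC i).2 u.
    by move=> ui; apply: nu; rewrite (bigD1 i)//=; left.
  have ok i : (jC i).2 u <-> xi u = i.
    by split=> h; apply: contrapT => h'; apply: (nu i); [right|left].
  case/eqP: xu; rewrite /xi'; case: pickP => [i /asboolP/ok ->//|/(_ (xi u))/asboolP].
  by case; apply/ok.
have mbad i : measurable (symdiff (xi @^-1` [set i]) (jC i).2).
  by apply: measurable_symdiff; [exact: mxi | exact: determined_measurable (jCP i).1].
have [mU leU] := fine_le_bigU mbad.
have EN : 1 - law mu E None <= c ^+ 2.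
  rewrite -(law_sum1 mu mE) (bigD1 None)//= addrAC subrr add0r.
  rewrite -(prob_label mu (fun a => a != None) mE).
  rewrite (@le_trans _ _ (fine (mu (\big[setU/set0]_i symdiff (xi @^-1` [set i]) (jC i).2))))//.
    apply: fine_le => //; first exact: label_preimage.
    by move=> u /= Eu; apply: bad => /=; apply: contra_neqN Eu => /eqP; rewrite /E => ->; rewrite eqxx.
  rewrite (le_trans leU)// (le_trans (ler_sum _ (fun i _ => (jCP i).2)))//.
  by rewrite sumr_const card_ord -[leLHS]mulr_natr mulfVK// pnatr_eq0.
exists j => n.
have mS := @measurable_shift N.
have -> : itinerary S xi n = (fun ab : n.-tuple 'I_k.+1 * n.-tuple (option 'I_k.+1) =>
   [tuple odflt (tnth ab.1 i) (tnth ab.2 i) | i < n]) \o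
   (fun u => (itinerary S xi' n u, itinerary S E n u)).
  apply/funext => u; apply: eq_from_tnth => i /=; rewrite !tnth_mktuple /= /E.
  by case: eqP.
have lxi : label (itinerary S xi' n) by exact: (label_itinerary mS muS mxi').
have lE : label (itinerary S E n) by exact: (label_itinerary mS muS mE).
apply: (le_trans (shannon_comp mu _ (label_pair lxi lE))).
apply: (le_trans (shannon_pair mu lxi lE)); apply: lerD; last first.
  apply: (le_trans (shannon_itinerary_le mS muS n mE)); rewrite ler_wpM2l//.
  apply: (le_trans (shannon_option mE _ EN)); first by rewrite ltW.
  by rewrite card_ord.
have -> : itinerary S xi' n = (fun w : (j + n).-tuple A => itinerary S xi' n (padded w)) \o
    (word (j + n) : borel_strings N -> _).
  apply/funext => u; apply: eq_from_tnth => i; rewrite !tnth_mktuple/=.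
  apply: xi'j; apply: (@word_le _ _ (j + n - i)).
    by rewrite -[X in (X <= _)%N](addnK i) leq_sub2r// leq_add2l ltnW.
  apply: word_shift; rewrite subnKC; first exact: (esym (word_padded (word (j + n) u))).
  by rewrite (leq_trans (ltnW (ltn_ord i)))// leq_addl.
by apply: shannon_comp; exact: label_word.
Qed.

(* The partition into cylinders of length 1 generates. *)
Lemma partition_entropy_le_word k (xi : borel_strings N -> 'I_k) n :
    measurable_partition xi -> (0 < n)%N ->
  partition_entropy mu S xi <= n%:R^-1 * shannon mu (word n : borel_strings N -> _).
Proof.
move=> mxi n0; pose a n := shannon mu (word n : borel_strings N -> _).
have wordE n' : (word n' : borel_strings N -> _) =
    itinerary S (fun u : borel_strings N => u 0%N : A) n'.
  apply/funext => u; apply: eq_from_tnth => i.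
  by rewrite !tnth_mktuple iter_shift addn0.
have m1 : label (fun u : borel_strings N => u 0%N : A).
  by apply: (@label_factor _ _ 1) => u v /wordP; apply.
have subD p q : a (p + q)%N <= a p + a q.
  by rewrite /a !wordE; exact: (shannon_itineraryD (@measurable_shift N) muS p q m1).
have a0 p : 0 <= a p by apply: shannon_ge0; exact: label_word.
have [ca la] := fekete a0 subD.
apply: le_trans (la n n0).
apply/ler_addgt0Pl => e e0.
have e2 : 0 < e / 2 by rewrite divr_gt0.
have [j jxi] := shannon_itinerary_word mxi e2.
have e4 : 0 < e / 4 by rewrite divr_gt0.
have [p _ pL] := (cvgrPdist_le _ _).1 ca _ e4.
(* Long enough for the [j] extra letters to cost at most [e / 4] per unit of time. *)
pose q := (maxn p (Num.truncn (a j / (e / 4))).+1).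
have q0 : (0 < q)%N by rewrite /q leq_max orbT.
have q0' : 0 < q%:R :> R by rewrite ltr0n.
have := pL q (leq_maxl _ _); rewrite /= ler_norml => /andP[hL _].
have hj : q%:R^-1 * a j <= e / 4.
  rewrite ler_pdivrMl// -ler_pdivrMr// (le_trans (ltW (truncnS_gt _)))//.
  by rewrite ler_nat leq_maxr.
have := (partition_entropy_cvg (@measurable_shift N) muS mxi).2 q q0.
have : q%:R^-1 * shannon mu (itinerary S xi q) <= q%:R^-1 * a j + q%:R^-1 * a q + e / 2.
  rewrite -mulrDr -[e / 2](mulKf (x := q%:R)) ?gt_eqF// -mulrDr ler_wpM2l ?invr_ge0 ?(ltW q0')//.
  by rewrite (le_trans (jxi q))// lerD2r subD.
lra.
Qed.

End generator.

(** * Lower bound for the pressure *)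

Section birkhoff_sums.
Variables (R : realType) (N : nat).
Local Notation A := 'I_N.+1.
Local Notation S := (@shift_map N).
Implicit Types (u v : strings N) (g : strings N -> R).

Lemma birkhoff_sumD g m n u :
  birkhoff_sum g (m + n) u = birkhoff_sum g m u + birkhoff_sum g n (iter m S u).
Proof.
rewrite /birkhoff_sum big_split_ord/=; congr (_ + _).
by apply: eq_bigr => t _; rewrite -iterD addnC.
Qed.

Lemma birkhoff_sum_blocks g m q u :
  birkhoff_sum g (m * q) u = \sum_(j < q) birkhoff_sum g m (iter (m * j) S u).
Proof.
elim: q => [|q ih]; first by rewrite muln0 /birkhoff_sum !big_ord0.
by rewrite mulnS addnC birkhoff_sumD ih big_ord_recr.
Qed.

Lemma birkhoff_sum_bound g M n u : (forall v, `|g v| <= M) ->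
  `|birkhoff_sum g n u| <= n%:R * M.
Proof.
move=> gM; rewrite (le_trans (ler_norm_sum _ _ _))//.
have -> : n%:R * M = \sum_(t < n) M by rewrite sumr_const card_ord mulr_natl.
by apply: ler_sum => t _; exact: gM.
Qed.

Lemma birkhoff_distortion g (e : R) : continuous g -> 0 < e -> exists m0, forall m,
  (m0 <= m)%N -> forall u v, word m u = word m v ->
  `|birkhoff_sum g m u - birkhoff_sum g m v| <= m%:R * e.
Proof.
move=> cg e0; have e2 : 0 < e / 2 by rewrite divr_gt0.
have [k gk] := continuous_word cg e2; have [M gM] := continuous_bounded cg.
have M0 : 0 <= M by rewrite (le_trans _ (gM point)).
exists (k + Num.truncn (k%:R * (2 * M) / (e / 2))).+1%N => m km u v uv.
have kM : k%:R * (2 * M) <= m%:R * (e / 2).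
  rewrite -ler_pdivrMr// (le_trans (ltW (truncnS_gt _)))// ler_nat.
  by rewrite (leq_trans _ km)// ltnS leq_addl.
have [m' mE] : exists m', m = (m' + k)%N.
  by exists (m - k)%N; rewrite subnK// (leq_trans _ km)// leqW// leq_addr.
have h1 : `|birkhoff_sum g m' u - birkhoff_sum g m' v| <= m'%:R * (e / 2).
  rewrite /birkhoff_sum -sumrB (le_trans (ler_norm_sum _ _ _))//.
  have -> : m'%:R * (e / 2) = \sum_(t < m') e / 2 by rewrite sumr_const card_ord mulr_natl.
  apply: ler_sum => t _; apply: gk; apply: word_shift; apply: (word_le _ uv).
  by rewrite mE leq_add2r ltnW.
have h2 := birkhoff_sum_bound k (iter m' S u) gM.
have h3 := birkhoff_sum_bound k (iter m' S v) gM.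
have m'm : m'%:R * (e / 2) <= m%:R * (e / 2).
  by rewrite ler_wpM2r ?(ltW e2)// ler_nat mE leq_addr.
rewrite mE !birkhoff_sumD -mE.
move: h1 h2 h3; rewrite !ler_norml; lra.
Qed.

Lemma birkhoff_continuous g n : continuous g -> continuous (birkhoff_sum g n).
Proof.
move=> cg; elim: n => [|n ih].
  apply: word_continuous => e e0; exists 0%N => u v _.
  by rewrite /birkhoff_sum !big_ord0 subrr normr0 ltW.
apply: word_continuous => e e0; have e2 : 0 < e / 2 by rewrite divr_gt0.
have [j gj] := continuous_word ih e2; have [k gk] := continuous_word cg e2.
exists (maxn j (n + k)) => u v uv.
rewrite -addn1 !birkhoff_sumD /birkhoff_sum !big_ord1 /=.
have h1 := gj _ _ (word_le (leq_maxl _ _) uv).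
have h2 := gk _ _ (word_shift (word_le (leq_maxr _ _) uv)).
by rewrite opprD addrACA [leRHS]splitr (le_trans (ler_normD _ _))// lerD.
Qed.

Section invariant.
Variable mu : probability (borel_strings N) R.
Hypothesis muS : invariant_measure mu S.

Lemma Rintegral_shift g : continuous g -> \int[mu]_x g (S x) = \int[mu]_x g x.
Proof.
move=> cg; have mg := continuous_measurable_strings cg.
rewrite /Rintegral; congr fine.
have mS := @measurable_shift N.
have cgS : continuous (fun u => g (S u)).
  apply: word_continuous => e /(continuous_word cg)[k gk].
  by exists k.+1 => u v uv; apply: gk; apply: (@word_shift _ 1); rewrite add1n.
transitivity (\int[pushforward mu (S : borel_strings N -> borel_strings N)]_x (g x)%:E)%E.
  rewrite (integral_pushforward mS)//; first exact/measurable_realfun.measurable_EFinP.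
  exact: (continuous_integrable_strings _ cgS).
by apply: eq_measure_integral => B mB _; exact: muS.
Qed.

Lemma Rintegral_birkhoff g n : continuous g ->
  \int[mu]_x birkhoff_sum g n x = n%:R * \int[mu]_x g x.
Proof.
move=> cg.
have cgt t : continuous (fun u => g (iter t S u)).
  apply: word_continuous => e /(continuous_word cg)[k gk].
  by exists (t + k)%N => u v uv; apply: gk; exact: word_shift.
have igt t : \int[mu]_x g (iter t S x) = \int[mu]_x g x.
  elim: t => // t <-; rewrite -(Rintegral_shift (cgt t)).
  by apply: eq_Rintegral => x _; rewrite iterSr.
elim: n => [|n ih].
  rewrite mul0r (_ : (fun x => _) = cst 0) ?Rintegral_cst ?mul0r//.
  by apply/funext => x; rewrite /birkhoff_sum big_ord0.
have -> : (fun x => birkhoff_sum g n.+1 x) = (fun x => birkhoff_sum g n x + g (iter n S x)).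
  by apply/funext => x; rewrite /birkhoff_sum big_ord_recr.
rewrite RintegralD//.
- by rewrite ih igt -addn1 natrD mulrDl mul1r.
- exact: (continuous_integrable_strings _ (@birkhoff_continuous g n cg)).
- exact: (continuous_integrable_strings _ (cgt n)).
Qed.

End invariant.
End birkhoff_sums.

(** * Concatenations of typical blocks *)

Section concatenation.
Variables (N m q : nat).
Hypothesis m0 : (0 < m)%N.
Local Notation A := 'I_N.+1.
Local Notation S := (@shift_map N).

Definition concat_string (x : {ffun 'I_q -> m.-tuple A}) : strings N :=
  fun k => if insub (k %/ m)%N is Some j then nth ord0 (x j) (k %% m)%N else ord0.

Definition concat (x : {ffun 'I_q -> m.-tuple A}) : (m * q).-tuple A :=
  word (m * q) (concat_string x).

Lemma word_concat (x : {ffun 'I_q -> m.-tuple A}) u (j : 'I_q) :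
  word (m * q) u = concat x -> word m (iter (m * j) S u) = x j.
Proof.
move=> /wordP ux; apply/word_eqP => k km; rewrite iter_shift ux.
  rewrite /concat_string mulnC divnMDl// divn_small// addn0 modnMDl modn_small//.
  by case: insubP => [i _ /val_inj ->//|]; rewrite ltn_ord.
by rewrite (@leq_trans (m * j.+1))%N ?leq_mul2l ?ltn_ord ?orbT// mulnS addnC ltn_add2r.
Qed.

Lemma concat_inj : injective concat.
Proof.
move=> x y xy; apply/ffunP => j.
by rewrite -(@word_concat x (padded (concat x)) j) ?word_padded// xy (@word_concat y)// word_padded.
Qed.

End concatenation.

Section typical_averages.
Variables (R : realType) (N : nat).
Local Notation A := 'I_N.+1.
Local Notation S := (@shift_map N).
Variable mu : probability (borel_strings N) R.
Hypothesis muS : invariant_measure mu S.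

(** Three errors of [e] per letter: the variation of the sum over a block within its cylinder, the
    deviation of the block frequencies from the word law, and the replacement of the integral of a
    block sum by a sum over words. *)
Lemma birkhoff_typical (g : strings N -> R) (M e a : R) m q
    (x : {ffun 'I_q -> m.-tuple A}) u :
    (0 < m)%N -> continuous g -> (forall v, `|g v| <= M) ->
    (forall u v, word m u = word m v ->
      `|birkhoff_sum g m u - birkhoff_sum g m v| <= m%:R * e) ->
    (N.+1 ^ m)%:R * M * a <= e ->
    typical (@word_law R N mu m) a x -> word (m * q) u = concat x ->
  `|birkhoff_sum g (m * q) u - (m * q)%:R * \int[mu]_x g x| <= (m * q)%:R * (3 * e).
Proof.
move=> m0 cg gM dist Mae /forallP tx ux.
pose G (w : m.-tuple A) := birkhoff_sum g m (padded w).
have h1 : `|birkhoff_sum g (m * q) u - \sum_j G (x j)| <= q%:R * (m%:R * e).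
  rewrite birkhoff_sum_blocks -sumrB (le_trans (ler_norm_sum _ _ _))//.
  have -> : q%:R * (m%:R * e) = \sum_(j < q) m%:R * e by rewrite sumr_const card_ord mulr_natl.
  by apply: ler_sum => j _; apply: dist; rewrite word_padded; exact: word_concat.
have GE : \sum_j G (x j) = \sum_w occurrences R x w * G w.
  rewrite (eq_bigr (fun j => \sum_w (x j == w)%:R * G w)); last first.
    move=> j _; rewrite (bigD1 (x j))//= eqxx mul1r big1 ?addr0// => b.
    by rewrite eq_sym => /negbTE ->; rewrite mul0r.
  by rewrite exchange_big/=; apply: eq_bigr => b _; rewrite mulr_suml.
rewrite GE in h1.
have h2 : `|\sum_w occurrences R x w * G w - q%:R * \sum_w G w * word_law mu w| <= q%:R * (m%:R * e).
  rewrite mulr_sumr -sumrB (le_trans (ler_norm_sum _ _ _))//.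
  rewrite (@le_trans _ _ (\sum_(w : m.-tuple A) q%:R * a * (m%:R * M)))//.
    apply: ler_sum => w _.
    have -> : occurrences R x w * G w - q%:R * (G w * word_law mu w) =
      (occurrences R x w - q%:R * word_law mu w) * G w by ring.
    by rewrite normrM ler_pM//; exact: birkhoff_sum_bound.
  rewrite sumr_const card_tuple card_ord -[leLHS]mulr_natl.
  have -> : (N.+1 ^ m)%:R * (q%:R * a * (m%:R * M)) = q%:R * (m%:R * ((N.+1 ^ m)%:R * M * a)) by ring.
  by rewrite !ler_wpM2l.
have h3 : `|m%:R * \int[mu]_x g x - \sum_w G w * word_law mu w| <= m%:R * e.
  rewrite -(Rintegral_birkhoff muS m cg).
  exact: (Rintegral_word _ (@birkhoff_continuous _ _ g m cg) dist).
have q0 : 0 <= q%:R :> R by [].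
move: h3 => /(ler_wpM2l q0); rewrite -{1}(ger0_norm q0) -normrM => h3.
rewrite natrM; move: h1 h2 h3; rewrite mulrBr !ler_norml.
set I := \int[mu]_x _; set a1 := \sum_w _; set a2 := q%:R * \sum_w _; set b := birkhoff_sum _ _ _.
set c := q%:R * (m%:R * e).
have -> : q%:R * (m%:R * I) = m%:R * q%:R * I by ring.
have -> : m%:R * q%:R * (3 * e) = 3 * c by rewrite /c; ring.
lra.
Qed.

End typical_averages.

Section cylinder_sup.
Variables (R : realType) (N : nat) (phi : strings N -> R).
Hypothesis cphi : continuous phi.
Local Notation A := 'I_N.+1.

Let sup_exp n (i : n.-tuple A) :=
  sup [set expR (birkhoff_sum phi n u) | u in cylinder i].

Lemma cylinder_sup_ge n (i : n.-tuple A) u : word n u = i ->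
  expR (birkhoff_sum phi n u) <= sup_exp i.
Proof.
move=> ui; have [M phiM] := continuous_bounded cphi.
apply: ub_le_sup; last by exists u => //; rewrite cylinderE.
exists (expR (n%:R * M)) => _ [v _ <-]; rewrite ler_expR.
exact: le_trans (ler_norm _) (birkhoff_sum_bound n v phiM).
Qed.

Lemma cylinder_sup_le n (i : n.-tuple A) c :
  (forall u, word n u = i -> birkhoff_sum phi n u <= c) -> sup_exp i <= expR c.
Proof.
move=> h; apply: ge_sup.
  by exists (expR (birkhoff_sum phi n (padded i))), (padded i) => //; rewrite cylinderE; exact: word_padded.
by move=> _ [u + <-]; rewrite cylinderE /= ler_expR => /h.
Qed.

Lemma cylinder_sup_ge0 n (i : n.-tuple A) : 0 <= sup_exp i.
Proof. exact: le_trans (expR_ge0 _) (cylinder_sup_ge (word_padded i)). Qed.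

End cylinder_sup.

Section growth_rate.
Variables (R : realType) (N : nat) (X : metricType R).
Variables (U : weak_probability R N -> X) (V : set X) (phi : strings N -> R).

(** For an upper limit it is enough to treat arbitrarily large lengths, later those of the form
    [m * q]. *)
Lemma upper_pressure_ge_rate (c : R) :
    (forall e n0, 0 < e -> exists n, (n0 <= n)%N /\
      expR (n%:R * (c - e)) <= partition_sum U V phi n) ->
  (c%:E <= upper_pressure U V phi)%E.
Proof.
move=> h; apply: le_ereal_inf_tmp => _ [W [n0 _ n0W] <-].
apply/lee_addgt0Pr => e e0; rewrite -leeBlDr// -EFinB.
have [n [n0n Zn]] := h e (maxn n0 1) e0.
move: n0n; rewrite geq_max => /andP[n0n n1].
apply: le_trans (ereal_sup_ubound _); last by exists n => //; exact: n0W.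
have Z0 : 0 < partition_sum U V phi n by rewrite (lt_le_trans _ Zn)// expR_gt0.
rewrite lne_EFin// -EFinM lee_fin ler_pdivlMl ?ltr0n//.
by rewrite -(expRK (n%:R * (c - e))) ler_ln// posrE expR_gt0.
Qed.

Lemma upper_pressure_le_rate (c : R) n0 :
    (forall n, (n0 <= n)%N -> partition_sum U V phi n <= expR (n%:R * c)) ->
  (upper_pressure U V phi <= c%:E)%E.
Proof.
move=> h; apply: (@le_trans _ _ (ereal_sup
    ((fun n => (n%:R^-1)%:E * lne (partition_sum U V phi n)%:E)%E @` [set n | (maxn n0 1 <= n)%N]))).
  by apply: ereal_inf_lbound; exists [set n | (maxn n0 1 <= n)%N] => //; exists (maxn n0 1).
apply: ge_ereal_sup => _ [n /= + <-]; rewrite geq_max => /andP[n0n n1].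
rewrite /=; have [Z0|Z0] := ltP 0 (partition_sum U V phi n).
  rewrite -EFinM lee_fin ler_pdivrMl ?ltr0n//.
  by rewrite -(expRK (n%:R * c)) ler_ln ?posrE ?expR_gt0// h.
(* A sum without terms has logarithm -oo. *)
by rewrite mulrNy gtr0_sg ?invr_gt0 ?ltr0n// mul1e leNye.
Qed.

End growth_rate.

Section lower_bound.
Variables (R : realType) (N : nat) (X : metricType R).
Variables (U : weak_probability R N -> X) (V : set X) (phi : strings N -> R).
Local Notation A := 'I_N.+1.
Local Notation S := (@shift_map N : borel_strings N -> borel_strings N).

Lemma upper_pressure_ge (mu : probability (borel_strings N) R) k
    (xi : borel_strings N -> 'I_k) :
    continuous U -> nbhs (U mu) V -> continuous phi ->
    invariant_measure mu S -> measurable_partition xi ->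
  ((partition_entropy mu S xi + \int[mu]_x phi x)%:E <= upper_pressure U V phi)%E.
Proof.
move=> cU nV cphi muS mxi; set h := partition_entropy _ _ _; set P := \int[mu]_x _.
apply: upper_pressure_ge_rate => e0 n0 e00.
(* The loss per letter is [3 * e] in the Birkhoff sum, [e] in the log-likelihood of typical words
   and [e] for the factor 1/2 in their number. *)
pose e := e0 / 5; have e1 : 0 < e by rewrite divr_gt0.
have [K [d [d0 Kd]]] := weak_continuous_close cU nV.
(* The finitely many functions to be averaged at once: [phi], and the indicators of the words of
   length at most [K], which place the empirical measure near [mu]. *)
pose I := option {j : 'I_K.+1 & j.-tuple A}.
pose g (i : I) : strings N -> R :=
  if i is Some jw then fun u => (word (tag jw) u == tagged jw)%:R else phi.
have cg i : continuous (g i) by case: i => [jw|//]; exact: indicator_continuous.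
pose e' := Num.min e (d / 3).
have e'0 : 0 < e' by rewrite lt_min e1 divr_gt0.
have /choice[mi miP] := fun i => birkhoff_distortion (cg i) e'0.
have /choice[Mi MiP] := fun i => continuous_bounded (cg i).
have Mi0 i : 0 <= Mi i by rewrite (le_trans _ (MiP i point)).
pose M := 1 + \sum_i Mi i.
have M0 : 0 < M by rewrite ltr_pwDl// sumr_ge0.
have gM i v : `|g i v| <= M.
  rewrite (le_trans (MiP i v))// /M (bigD1 i)//= addrCA lerDl addr_ge0// sumr_ge0//.
pose m := (\max_i mi i).+1.
have mim i : (mi i <= m)%N by rewrite /m (bigD1 i)//= ltnW// ltnS leq_maxl.
have m1 : 0 < m%:R :> R by rewrite ltr0n.
pose p := @word_law R N mu m.
have p0 w : 0 <= p w by exact: law_ge0.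
have p1 : \sum_w p w = 1 by apply: law_sum1; exact: label_word.
pose L := \sum_w `|ln (p w)|.
have L0 : 0 <= L by exact: sumr_ge0.
have NM0 : 0 < (N.+1 ^ m)%:R * M by rewrite mulr_gt0// ltr0n expn_gt0.
(* The tolerance on block frequencies: one bound controls the averages of all [g i], the other the
   log-likelihood. *)
pose a := Num.min (e' / ((N.+1 ^ m)%:R * M)) (m%:R * e / (1 + L)).
have L1 : 0 < 1 + L by rewrite ltr_pwDl.
have a0 : 0 < a by rewrite lt_min !divr_gt0// mulr_gt0.
have aM : (N.+1 ^ m)%:R * M * a <= e' by rewrite mulrC -ler_pdivlMr// ge_min lexx.
have aL : a * L <= m%:R * e.
  rewrite (@le_trans _ _ (a * (1 + L)))//; first by rewrite ler_wpM2l ?(ltW a0)// lerDr.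
  by rewrite -ler_pdivlMr// ge_min lexx orbT.
(* Large enough for Chebyshev's inequality, and for [q * e >= 1], by which
   [expR (- (q * e)) <= 1 / 2]. *)
pose q := maxn (maxn n0 1) (maxn (Num.truncn (2 * #|{: m.-tuple A}|%:R / a ^+ 2)).+1 (Num.truncn e^-1).+1).
have q1 : (0 < q)%N by rewrite /q !leq_max orbT.
have qn0 : (n0 <= q)%N by rewrite /q !leq_max leqnn.
have qe : 1 <= q%:R * e.
  rewrite -ler_pdivrMr// mul1r (le_trans (ltW (truncnS_gt _)))// ler_nat /q.
  by rewrite !leq_max leqnn !orbT.
have qB : 2 * #|{: m.-tuple A}|%:R <= q%:R * a ^+ 2.
  rewrite -ler_pdivrMr ?exprn_gt0// (le_trans (ltW (truncnS_gt _)))// ler_nat /q.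
  by rewrite !leq_max leqnn !orbT.
exists (m * q)%N; split; first by rewrite (leq_trans qn0)// leq_pmull.
have card := card_typical_ge p0 p1 a0 q1 qB.
have avg (x : {ffun 'I_q -> m.-tuple A}) u i : typical p a x -> word (m * q) u = concat x ->
    `|birkhoff_sum (g i) (m * q) u - (m * q)%:R * \int[mu]_x g i x| <= (m * q)%:R * (3 * e').
  move=> tx ux; apply: (birkhoff_typical muS _ (cg i) (gM i) _ aM tx ux) => //.
  by apply: miP; exact: mim.
have mq0 : (0 < m * q)%N by rewrite muln_gt0.
have good (x : {ffun 'I_q -> m.-tuple A}) : typical p a x ->
    [set U (empirical R (m * q) u) | u in cylinder (concat x)] `<=` V.
  move=> tx _ [u + <-]; rewrite cylinderE /= => ux; apply: Kd => j w jK.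
  have {jK}jK : (j < K.+1)%N by [].
  have := avg x u (Some (Tagged (fun j : 'I_K.+1 => j.-tuple A) (w : (Ordinal jK).-tuple A))) tx ux.
  rewrite /= (_ : \int[mu]_x _ = word_law mu w); last first.
    rewrite (Rintegral_label mu (fun v => (v == w)%:R) (@label_word N j)).
    by rewrite (bigD1 w)//= eqxx mul1r big1 ?addr0// => v /negbTE ->; rewrite mul0r.
  have [n nE] : exists n, (m * q)%N = n.+1 by exists (m * q).-1; rewrite prednK.
  rewrite nE /word_law law_empirical /birkhoff_sum => avgw.
  have n1 : 0 < n.+1%:R :> R by rewrite ltr0n.
  rewrite -(ler_pM2l n1) -[X in X * `|_|](ger0_norm (ltW n1)) -normrM mulrBr mulrA mulfV ?gt_eqF// mul1r.
  rewrite (le_trans avgw)// ler_wpM2l ?(ltW n1)//.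
  by rewrite mulrC -ler_pdivlMr// ge_min lexx orbT.
have termge (x : {ffun 'I_q -> m.-tuple A}) : typical p a x ->
    expR ((m * q)%:R * (P - 3 * e)) <=
    sup [set expR (birkhoff_sum phi (m * q) u) | u in cylinder (concat x)].
  move=> tx; apply: le_trans (cylinder_sup_ge cphi (word_padded (concat x))).
  rewrite ler_expR; have := avg x _ None tx (word_padded (concat x)).
  rewrite /= -/P ler_norml => /andP[+ _].
  have : (m * q)%:R * (3 * e') <= (m * q)%:R * (3 * e).
    by rewrite !ler_wpM2l// ge_min lexx.
  lra.
apply: (@le_trans _ _ (\sum_(x : {ffun 'I_q -> m.-tuple A} | typical p a x)
   sup [set expR (birkhoff_sum phi (m * q) u) | u in cylinder (concat x)])); last first.
  apply: (@ler_sum_inj _ _ _ (@concat N m q) _ _ (fun i => sup [set expR (birkhoff_sum phi (m * q) u) | u in cylinder i])).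
  - exact: concat_inj.
  - by move=> x tx; apply/asboolP; exact: good.
  - by move=> i; exact: cylinder_sup_ge0.
apply: (@le_trans _ _ (\sum_(x : {ffun 'I_q -> m.-tuple A} | typical p a x) expR ((m * q)%:R * (P - 3 * e)))); last first.
  exact: ler_sum.
have -> : \sum_(x : {ffun 'I_q -> m.-tuple A} | typical p a x) expR ((m * q)%:R * (P - 3 * e)) =
   #|[pred x : {ffun 'I_q -> m.-tuple A} | typical p a x]|%:R * expR ((m * q)%:R * (P - 3 * e)).
  set E := expR _; transitivity (\sum_(x in [pred x : {ffun 'I_q -> m.-tuple A} | typical p a x]) E).
    exact: eq_bigl.
  by rewrite sumr_const [RHS]mulr_natl.
have half : expR (- (q%:R * e)) <= 2^-1 :> R.
  rewrite expRN lef_pV2 ?posrE ?expR_gt0// (le_trans _ (expR_ge1Dx _))//; lra.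
have hm : m%:R * h <= \sum_w eta (p w).
  by rewrite -ler_pdivlMl//; exact: partition_entropy_le_word.
apply: (le_trans _ (ler_wpM2r (expR_ge0 _) card)).
apply: (@le_trans _ _ (expR (- (q%:R * e)) * expR (q%:R * (\sum_w eta (p w) - a * L)) * expR ((m * q)%:R * (P - 3 * e)))); last first.
  by rewrite ler_wpM2r ?expR_ge0// ler_wpM2r ?expR_ge0.
rewrite -!expRD ler_expR.
have qge : q%:R * e <= q%:R * (m%:R * e).
  by rewrite ler_wpM2l// ler_peMl ?(ltW e1)// ler1n.
have : q%:R * (m%:R * h - m%:R * e) <= q%:R * (\sum_w eta (p w) - a * L).
  by rewrite ler_wpM2l// lerB.
have -> : e0 = 5 * e by rewrite /e; field.
rewrite natrM; move: qge; set Q := q%:R; set mm := m%:R; set H := Q * (_ - a * L).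
have -> : Q * (mm * h - mm * e) = Q * mm * h - Q * (mm * e) by ring.
have -> : mm * Q * (h + P - 5 * e) = Q * mm * h + mm * Q * (P - 3 * e) - 2 * (Q * (mm * e)) by ring.
lra.
Qed.

End lower_bound.

(** * Measures with prescribed word weights *)

Section interval_coding.
Variables (R : realType) (N : nat).
Local Notation A := 'I_N.+1.
Variable p : seq A -> R.
Hypotheses (p0 : forall w, 0 <= p w) (pnil : p [::] = 1).
Hypothesis p_rcons : forall w, p w = \sum_a p (rcons w a).

(* The words of length [n] are sent to consecutive subintervals of [0, 1[
   of length [p w], in lexicographic order; [left_end] is the left endpoint. *)
Definition left_end (w : seq A) : R :=
  \sum_(i < size w) \sum_(c : A | (c < nth ord0 w i)%N) p (rcons (take i w) c).

Definition in_interval (x : R) (w : seq A) := left_end w <= x < left_end w + p w.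

Let cumul w j := \sum_(c : A | (c < j)%N) p (rcons w c).

Let left_end_rcons w a : left_end (rcons w a) = left_end w + cumul w a.
Proof.
rewrite /left_end size_rcons big_ord_recr/= nth_rcons ltnn eqxx; congr (_ + _).
  apply: eq_bigr => i _; rewrite nth_rcons ltn_ord.
  by apply: eq_bigr => c _; rewrite -[rcons w a]cats1 takel_cat// ltnW.
by apply: eq_bigr => c _; rewrite -[rcons w a]cats1 take_size_cat.
Qed.

Let cumulS w (a : A) : cumul w a.+1 = cumul w a + p (rcons w a).
Proof.
rewrite /cumul (bigD1 a)//= addrC; congr (_ + _); apply: eq_bigl => c.
by rewrite ltnS ltn_neqAle andbC.
Qed.

Let cumul_max w : cumul w N.+1 = p w.
Proof. by rewrite p_rcons; apply: eq_bigl => c; rewrite ltn_ord. Qed.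

Let cumul_le w j k : (j <= k)%N -> cumul w j <= cumul w k.
Proof.
move=> jk; rewrite /cumul [leRHS]big_mkcond [leLHS]big_mkcond; apply: ler_sum => c _.
by case: ifPn => [cj|_]; [rewrite (leq_trans cj jk)|case: ifP].
Qed.

Let in_interval_split x w : in_interval x w -> exists a, in_interval x (rcons w a).
Proof.
move=> /andP[wx]; rewrite -(cumul_max w).
suff gen j : (j <= N.+1)%N -> x < left_end w + cumul w j -> exists a, in_interval x (rcons w a).
  exact: gen.
elim: j => [_|j ih jN xj]; first by rewrite /cumul big_pred0_eq// addr0 ltNge wx.
have [xj'|xj'] := ltP x (left_end w + cumul w j); first exact: (ih (ltnW jN)).
exists (Ordinal jN); rewrite /in_interval left_end_rcons xj'/=.
by move: xj; rewrite (cumulS w (Ordinal jN)) addrA.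
Qed.

Let in_interval_inj x w a b :
  in_interval x (rcons w a) -> in_interval x (rcons w b) -> a = b.
Proof.
suff h (c d : A) : (c < d)%N -> in_interval x (rcons w c) -> in_interval x (rcons w d) -> False.
  move=> ha hb; apply/val_inj; case: (ltngtP a b) => // ab; exfalso.
    exact: h ab ha hb.
  exact: h ab hb ha.
move=> cd /andP[_]; rewrite left_end_rcons -addrA -cumulS => xc /andP[+ _].
rewrite left_end_rcons leNgt (lt_le_trans xc)// lerD2l.
exact: cumul_le.
Qed.

Let in_interval_rcons x w a : in_interval x (rcons w a) -> in_interval x w.
Proof.
rewrite /in_interval left_end_rcons -addrA -cumulS => /andP[h1 h2]; apply/andP; split.
  by rewrite (le_trans _ h1)// lerDl sumr_ge0.
by rewrite (lt_le_trans h2)// lerD2l -cumul_max; exact: cumul_le.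
Qed.

Let in_interval_unit x w : in_interval x w -> 0 <= x < 1.
Proof.
elim/last_ind: w => [|w a ih /in_interval_rcons/ih//].
by rewrite /in_interval /left_end big_ord0 pnil add0r.
Qed.

(** Outside [0, 1[ no interval contains [x] and all digits take the default value, so the code is
    measurable on the whole line. *)
Let digit x w : A := odflt ord0 [pick a | in_interval x (rcons w a)].

Let digits x n := iter n (fun w => rcons w (digit x w)) [::].

Let code x : strings N := fun n => digit x (digits x n).

Let size_digits x n : size (digits x n) = n.
Proof. by elim: n => //= n ih; rewrite size_rcons ih. Qed.

Let nth_digits x n k : (k < n)%N -> nth ord0 (digits x n) k = code x k.
Proof.
elim: n => // n ih; rewrite /= nth_rcons size_digits ltnS leq_eqVlt => /predU1P[->|kn].
  by rewrite ltnn eqxx.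
by rewrite kn ih.
Qed.

Let word_code x k : word k (code x) = digits x k :> seq A.
Proof.
apply: (@eq_from_nth _ ord0); first by rewrite size_tuple size_digits.
move=> i; rewrite size_tuple => ik; rewrite nth_digits//.
by have /word_eqP/(_ i ik) := erefl (word k (code x)).
Qed.

Let digits_in x n : 0 <= x < 1 -> in_interval x (digits x n).
Proof.
move=> x01; elim: n => [|n ih].
  by rewrite /in_interval /left_end big_ord0 pnil add0r.
rewrite /= /digit; case: pickP => [a //|h].
by have [a] := in_interval_split ih; rewrite h.
Qed.

Let digits_eq x w : in_interval x w -> digits x (size w) = w.
Proof.
elim/last_ind: w => // w a ih h; have hw := in_interval_rcons h.
rewrite size_rcons /= (ih hw); congr rcons; rewrite /digit.
by case: pickP => [b hb|/(_ a)]; [exact: in_interval_inj hb h|rewrite h].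
Qed.

Let digits_out x n : ~~ (0 <= x < 1) -> digits x n = nseq n ord0.
Proof.
move=> x01; elim: n => [//|n ih].
rewrite [LHS]/= ih -[n.+1]addn1 nseqD cats1; congr rcons.
rewrite /digit; case: pickP => // a ha; case/negP : x01; exact: in_interval_unit ha.
Qed.

Let unit_itv : set R := [set` `[0, 1[].

Let code_preimage k (w : k.-tuple A) :
  [set x | word k (code x) = w] `&` unit_itv = [set` `[left_end w, left_end w + p w[].
Proof.
apply/seteqP; split => x /=; rewrite !in_itv/=.
  move=> [/(congr1 val)/=]; rewrite word_code => <- x01.
  exact: digits_in.
move=> h; split; last exact: in_interval_unit h.
by apply: val_inj; have := digits_eq h; rewrite size_tuple /= word_code.
Qed.

Let code_preimage_out k (w : k.-tuple A) :
  [set x | word k (code x) = w] `&` ~` unit_itv = if val w == nseq k ord0 then ~` unit_itv else set0.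
Proof.
have uE x : unit_itv x = (0 <= x < 1) by rewrite /unit_itv /= in_itv.
case: ifPn => [/eqP wE|wE]; apply/seteqP; split => x //.
- by case.
- move=> x01; split => //; apply: val_inj; rewrite /= word_code wE digits_out//.
  by apply/negP; rewrite -uE.
move=> [/(congr1 val)/= + x01]; rewrite word_code digits_out//; last by apply/negP; rewrite -uE.
by move=> e; case/eqP: wE; exact/esym.
Qed.

Let measurable_code :
  measurable_fun setT (code : measurableTypeR R -> borel_strings N).
Proof.
move=> _ B; rewrite setTI; move: B.
apply: (@borel_strings_min N (fun B : set (borel_strings N) => measurable ((code : measurableTypeR R -> _) @^-1` B))).
  split => [|B mB|F mF].
  - by rewrite preimage_set0.
  - by rewrite setTD preimage_setC; exact: measurableC.
  - by rewrite preimage_bigcup; exact: bigcup_measurable.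
move=> k w; rewrite (_ : _ @^-1` _ = [set x | word k (code x) = w])//.
rewrite -[X in measurable X](setUIDK _ unit_itv) setDE code_preimage code_preimage_out.
apply: measurableU; first exact: measurable_itv.
by case: ifP => // _; apply: measurableC; exact: measurable_itv.
Qed.

(** The measure is the law of the digit code of a uniform point of [0, 1[: the points whose code
    begins with [w] form the interval of [w], of length [p w]. *)
Lemma kolmogorov_words : exists mu : probability (borel_strings N) R,
  forall k (w : k.-tuple A), word_law mu w = p w.
Proof.
have mI : measurable unit_itv by exact: measurable_itv.
pose f : {mfun measurableTypeR R >-> borel_strings N} :=
  HB.pack (code : measurableTypeR R -> borel_strings N)
    (isMeasurableFun.Build _ _ _ _ _ measurable_code).
pose m := mrestr (@lebesgue_measure R) mI.
have m1 : m setT = 1%E.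
  by rewrite /m /mrestr setTI lebesgue_measure_itv/= lte_fin ltr01 oppr0 adde0.
pose P : probability _ R := HB.pack m (Measure_isProbability.Build _ _ _ m m1).
exists (distribution P f) => k w; rewrite /word_law /law.
transitivity (fine (lebesgue_measure [set` `[left_end w, left_end w + p w[])).
  by rewrite -code_preimage.
rewrite lebesgue_measure_itv/= lte_fin ltrDl; case: ltP => [_|].
  by rewrite -EFinD addrAC subrr add0r.
by move=> pw; apply/esym/eqP; rewrite /= eq_le pw p0.
Qed.

End interval_coding.

(** * Upper bound for the pressure *)

Section word_frequencies.
Variables (R : realType) (N : nat).
Local Notation A := 'I_N.+1.
Local Notation S := (@shift_map N).
Implicit Types (u v : strings N) (w : seq A).

(** Words are plain sequences here, so that weights of all lengths live in one product space. *)
Definition starts_with w v := mkseq (v : nat -> A) (size w) == w.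

Definition frequency n u w : R := n%:R^-1 * \sum_(t < n) (starts_with w (iter t S u))%:R.

Lemma starts_withE k (w : k.-tuple A) v : starts_with w v = (word k v == w).
Proof.
rewrite /starts_with size_tuple -val_eqE; congr (_ == _).
by rewrite /mkseq -val_enum_ord -map_comp.
Qed.

Lemma frequencyE n u k (w : k.-tuple A) : word_law (empirical R n.+1 u) w = frequency n.+1 u w.
Proof.
rewrite /word_law law_empirical; congr (_ * _); apply: eq_bigr => t _.
by rewrite starts_withE.
Qed.

Let sum_starts_rcons w v : \sum_a (starts_with (rcons w a) v)%:R = (starts_with w v)%:R :> R.
Proof.
have E a : starts_with (rcons w a) v = starts_with w v && ((v (size w) : A) == a).
  by rewrite /starts_with size_rcons mkseqS eqseq_rcons.
rewrite (bigD1 (v (size w) : A))//= E eqxx andbT big1 ?addr0// => a av.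
by rewrite E eq_sym (negbTE av) andbF.
Qed.

Let sum_starts_cons w v : \sum_a (starts_with (a :: w) v)%:R = (starts_with w (S v))%:R :> R.
Proof.
have E a : starts_with (a :: w) v = ((v 0%N : A) == a) && starts_with w (S v).
  rewrite /starts_with /= /mkseq /= eqseq_cons; congr (_ && (_ == _)).
  by rewrite -[1%N]addn0 iotaDl -map_comp.
rewrite (bigD1 (v 0%N : A))//= E eqxx big1 ?addr0// => a av.
by rewrite E eq_sym (negbTE av).
Qed.

Lemma frequency_ge0 n u w : 0 <= frequency n u w.
Proof. by rewrite mulr_ge0 ?invr_ge0// sumr_ge0. Qed.

Lemma frequency_le1 n u w : frequency n u w <= 1.
Proof.
case: n => [|n]; first by rewrite /frequency big_ord0 mulr0.
rewrite ler_pdivrMl ?ltr0n// mulr1 (@le_trans _ _ (\sum_(t < n.+1) 1))//.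
  by apply: ler_sum => t _; rewrite lern1 leq_b1.
by rewrite sumr_const card_ord.
Qed.

Lemma frequency_nil n u : frequency n.+1 u [::] = 1.
Proof.
by rewrite /frequency (eq_bigr (fun=> 1))// sumr_const card_ord mulVf// pnatr_eq0.
Qed.

Lemma frequency_rcons n u w : frequency n u w = \sum_a frequency n u (rcons w a).
Proof.
rewrite /frequency -mulr_sumr; congr (_ * _); rewrite exchange_big/=.
by apply: eq_bigr => t _; rewrite sum_starts_rcons.
Qed.

(** Summing over the left letter shifts the starting times by one, and the counts telescope to the
    two extreme times. Consistency is thus exact on the right, and asymptotic on the left. *)
Lemma frequency_cons n u w :
  `|\sum_a frequency n u (a :: w) - frequency n u w| <= n%:R^-1.
Proof.
have -> : \sum_a frequency n u (a :: w) - frequency n u w =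
    n%:R^-1 * ((starts_with w (iter n S u))%:R - (starts_with w u)%:R).
  rewrite /frequency -mulr_sumr exchange_big/= -mulrBr; congr (_ * _).
  under eq_bigr do rewrite sum_starts_cons.
  elim: n => [|n ih]; first by rewrite !big_ord0 !subrr.
  rewrite !big_ord_recr/=; move: ih; lra.
rewrite normrM ger0_norm ?invr_ge0// -[leRHS]mulr1 ler_wpM2l ?invr_ge0//.
by rewrite ler_norml; do 2 case: starts_with; rewrite /=; lra.
Qed.

End word_frequencies.

(** * The limiting measure *)

Section upper_bound.
Variables (R : realType) (N : nat) (X : metricType R).
Variables (U : weak_probability R N -> X) (C : set X) (phi : strings N -> R).
Hypotheses (cU : continuous U) (cphi : continuous phi).
Hypothesis P0 : forall r, 0 < r -> (0 <= upper_pressure U (neighborhood C r) phi)%E.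
Local Notation A := 'I_N.+1.
Local Notation S := (@shift_map N : borel_strings N -> borel_strings N).
Local Notation weights := {ptws (seq A) -> R}.

Let term n (i : n.-tuple A) := sup [set expR (birkhoff_sum phi n u) | u in cylinder i].

Let term_ge0 n (i : n.-tuple A) : 0 <= term i.
Proof. exact: cylinder_sup_ge0. Qed.

Let inside r n (i : n.-tuple A) :=
  `[< [set U (empirical R n u) | u in cylinder i] `<=` neighborhood C r >].

Let freq n (i : n.-tuple A) : weights := frequency R n (padded i).

Let mass n r (V : set weights) : R :=
  \sum_(i : n.-tuple A | inside r i && `[< V (freq i) >]) term i.

(** Frequencies in [V] are negligible, for some radius, against pressures that are at least 0.
    Smaller radii have smaller masses, so finitely many small sets share a radius. *)
Let small (V : set weights) := exists r e n0, [/\ 0 < r, 0 < e &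
  forall n, (n0 <= n)%N -> mass n r V <= expR (- (n%:R * e))].

Let mass_le n r r' (V V' : set weights) : r <= r' -> V `<=` V' ->
  mass n r V <= mass n r' V'.
Proof.
move=> rr VV; rewrite /mass [leLHS]big_mkcond [leRHS]big_mkcond; apply: ler_sum => i _.
case: ifPn => [/andP[/asboolP iC /asboolP Vi]|_]; last by case: ifP.
rewrite ifT//; apply/andP; split; apply/asboolP; last exact: VV.
by move=> x /iC /lt_le_trans; apply; rewrite lee_fin.
Qed.

Let massU n r (V V' : set weights) : mass n r (V `|` V') <= mass n r V + mass n r V'.
Proof.
rewrite /mass [leLHS]big_mkcond [X in X + _]big_mkcond [X in _ + X]big_mkcond -big_split.
apply: ler_sum => i _ /=; case: (inside r i) => /=; last by rewrite addr0.
case: asboolP => [[Vi|Vi]|_].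
- by rewrite (asboolT Vi) lerDl; case: ifP.
- by rewrite (asboolT Vi) lerDr; case: ifP.
- by rewrite addr_ge0//; case: ifP.
Qed.

Let small_sub (V V' : set weights) : V `<=` V' -> small V' -> small V.
Proof.
move=> VV [r [e [n0 [r0 e0 h]]]]; exists r, e, n0; split => // n /h.
by apply: le_trans; exact: mass_le.
Qed.

Let smallU (V V' : set weights) : small V -> small V' -> small (V `|` V').
Proof.
move=> [r [e [n0 [r0 e0 h]]]] [r' [e' [n0' [r0' e0' h']]]].
(* Half of the common rate is given up to absorb the factor 2 of the union. *)
pose r2 := Num.min r r'; pose e2 := Num.min e e' / 2.
have e20 : 0 < e2 by rewrite divr_gt0// lt_min e0.
exists r2, e2, (maxn (maxn n0 n0') (Num.truncn e2^-1).+1); split => //.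
  by rewrite lt_min r0.
move=> n; rewrite !geq_max => /andP[/andP[n0n n0'n] en].
have ne2 : 1 <= n%:R * e2.
  rewrite -ler_pdivrMr// mul1r (le_trans (ltW (truncnS_gt _)))// ler_nat//.
have le2 : e2 * 2 <= e /\ e2 * 2 <= e'.
  by rewrite /e2 mulfVK// !ge_min !lexx orbT.
have hV : mass n r2 V <= expR (- (n%:R * (e2 * 2))).
  apply: le_trans (le_trans (h n n0n) _); first by apply: mass_le; rewrite ?ge_min ?lexx.
  by rewrite ler_expR lerN2 ler_wpM2l// le2.1.
have hV' : mass n r2 V' <= expR (- (n%:R * (e2 * 2))).
  apply: le_trans (le_trans (h' n n0'n) _); first by apply: mass_le; rewrite ?ge_min ?lexx ?orbT.
  by rewrite ler_expR lerN2 ler_wpM2l// le2.2.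
rewrite (le_trans (massU _ _ _ _))// (le_trans (lerD hV hV'))//.
have -> : - (n%:R * (e2 * 2)) = - (n%:R * e2) + - (n%:R * e2) by ring.
rewrite expRD; set E := expR _; have E0 : 0 <= E by exact: expR_ge0.
have E2 : E * 2 <= 1.
  rewrite /E expRN mulrC ler_pdivrMr ?expR_gt0// mul1r.
  by rewrite (le_trans _ (expR_ge1Dx _))//; lra.
by rewrite -mulrDr -[leRHS]mulr1 ler_wpM2l//; lra.
Qed.

(** Here nonnegativity of the pressures enters: exponential decay of a full partition sum would make
    its pressure negative. *)
Let not_smallT : ~ small setT.
Proof.
move=> [r [e [n0 [r0 e0 h]]]].
have : (upper_pressure U (neighborhood C r) phi <= (- e)%:E)%E.
  apply: (@upper_pressure_le_rate _ _ _ _ _ _ _ n0) => n /h; rewrite mulrN; apply: le_trans.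
  rewrite le_eqVlt; apply/orP; left; apply/eqP; apply: eq_bigl => i.
  by rewrite [X in _ && X]asboolT ?andbT.
move=> /(le_trans (P0 r0)); rewrite lee_fin; lra.
Qed.

(* The complements of small sets form a proper filter, and a cluster point of
   it is a system of weights all of whose neighbourhoods carry the pressure. *)
Let cluster_weights : exists p : weights, forall V, nbhs p V -> ~ small V.
Proof.
pose F : set_system weights := [set V | small (~` V)].
have FF : ProperFilter F.
  split; first by rewrite /F /= setC0; exact: not_smallT.
  split.
  - rewrite /F /= setCT; exists 1, 1, 0%N; split => // n _.
    by rewrite /mass big_pred0 ?expR_ge0// => i; rewrite [X in _ && X]asboolF ?andbF.
  - by move=> V W; rewrite /F /= setCI; exact: smallU.
  - by move=> V W VW; apply: small_sub; exact: subsetC.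
pose K : set weights := [set f | forall w, `[0, 1]%classic (f w)].
have cK : compact K.
  by apply: (@tychonoff (seq A) (fun _ => R) (fun _ => `[0, 1]%classic)) => w; exact: segment_compact.
have FK : F K.
  exists 1, 1, 0%N; split => // n _; rewrite /mass big_pred0 ?expR_ge0// => i.
  rewrite [X in _ && X]asboolF ?andbF// => h; apply: h => w; rewrite /= in_itv/=.
  by rewrite frequency_ge0 frequency_le1.
have [p [_ clp]] := cK F FF FK.
exists p => V nV sV.
have [|f [Vf nVf]] := clp (~` V) V _ nV; last by [].
by rewrite /F /= setCK.
Qed.

Let p := sval (cid cluster_weights).

Definition near_weights k (d : R) (f g : seq A -> R) :=
  forall w, (size w <= k)%N -> `|f w - g w| <= d.

Let nbhs_near k (d : R) : 0 < d -> nbhs (p : weights) [set f | near_weights k d f p].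
Proof.
move=> d0.
pose I := {j : 'I_k.+1 & j.-tuple A}.
have H (jw : I) : nbhs (p : weights) [set f : seq A -> R | `|f (tagged jw) - p (tagged jw)| <= d].
  apply: (@proj_continuous _ (fun _ : seq A => R) (tagged jw : seq A) p
    [set y | `|y - p (tagged jw)| <= d]).
  by apply/nbhs_ballP; exists d => // y /ltW py /=; rewrite distrC.
have HI := @filter_forall weights I _ _ (@nbhs_filter weights p) H.
apply: (@filterS _ _ (@nbhs_filter weights p) _ _ _ HI) => f /= h w wk.
exact: (h (Tagged (fun j : 'I_k.+1 => j.-tuple A) (in_tuple w : (Ordinal (wk : (size w < k.+1)%N)).-tuple A))).
Qed.

Let mass_large k (d r e : R) n0 : 0 < d -> 0 < r -> 0 < e -> exists n,
  [/\ (n0 <= n)%N, (0 < n)%N &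
    expR (- (n%:R * e)) < mass n r [set f | near_weights k d f p]].
Proof.
move=> d0 r0 e0; apply: contrapT => h.
apply: (svalP (cid cluster_weights) _ (nbhs_near k d0)).
exists r, e, (maxn n0 1); split => // n; rewrite geq_max => /andP[n0n n1].
by rewrite leNgt; apply/negP => hn; apply: h; exists n.
Qed.

(** A positive mass has at least one term. Relations between frequencies pass to [p] through the
    long words obtained here. *)
Let near_freq k (d r : R) n0 : 0 < d -> 0 < r -> exists n (i : n.+1.-tuple A),
  [/\ (n0 <= n)%N, inside r i & near_weights k d (freq i) p].
Proof.
move=> d0 r0; have [n [n0n n1 h]] := mass_large k n0.+1 d0 r0 ltr01.
case: n n0n n1 h => // n n0n _ h.
have [i /andP[ri /asboolP ni]|none] := pickP (fun i : n.+1.-tuple A =>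
    inside r i && `[< near_weights k d (freq i) p >]); first by exists n, i.
by move: h; rewrite /mass big_pred0// ltNge expR_ge0.
Qed.

Let le_small (x c : R) : 0 <= c -> (forall d, 0 < d -> x <= c * d) -> x <= 0.
Proof.
move=> c0 h; apply/ler_addgt0Pl => e e0; rewrite addr0.
have c1 : 0 < c + 1 by rewrite ltr_wpDl.
apply: (le_trans (h (e / (c + 1)) _)); first by rewrite divr_gt0.
by rewrite mulrCA ger_pMr// ler_pdivrMr// mul1r lerDl.
Qed.

Let p_ge0 w : 0 <= p w.
Proof.
rewrite -oppr_le0; apply: (@le_small _ 1) => // d d0; rewrite mul1r.
have [n [i [_ _ /(_ w (leqnn _))]]] := near_freq (size w) 0 d0 ltr01.
have := frequency_ge0 R n.+1 (padded i) w; rewrite -/(freq i) ler_norml; lra.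
Qed.

Let p_nil : p [::] = 1.
Proof.
apply/eqP; rewrite -subr_eq0 -normr_le0; apply: (@le_small _ 1) => // d d0; rewrite mul1r.
have [n [i [_ _ /(_ [::] isT)]]] := near_freq 0 0 d0 ltr01.
by rewrite /freq frequency_nil distrC.
Qed.

Let sum_near k (d : R) (f : seq A -> R) (s : A -> seq A) : near_weights k d f p ->
  (forall a, (size (s a) <= k)%N) -> `|\sum_a f (s a) - \sum_a p (s a)| <= N.+1%:R * d.
Proof.
move=> nf sk; rewrite -sumrB (le_trans (ler_norm_sum _ _ _))//.
have -> : N.+1%:R * d = \sum_(a : A) d by rewrite sumr_const card_ord mulr_natl.
by apply: ler_sum => a _; exact: nf.
Qed.

Let p_rcons w : p w = \sum_a p (rcons w a).
Proof.
apply/eqP; rewrite -subr_eq0 -normr_le0; apply: (@le_small _ (1 + N.+1%:R)); first by rewrite addr_ge0.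
move=> d d0.
have [n [i [_ _ ni]]] := near_freq (size w).+1 0 d0 ltr01.
have h1 := ni w (leqnSn _).
have h2 := @sum_near _ _ _ (rcons w) ni (fun a => eq_leq (size_rcons w a)).
move: h1 h2; rewrite /freq -frequency_rcons !ler_norml; lra.
Qed.

(** With a length of at least [1 / d], the boundary error of the frequencies is at most [d]; another
    [d] comes from the weight of [w] and [N.+1] of them from its extensions. For the measure with
    weights [p] this is shift invariance. *)
Let p_cons w : \sum_a p (a :: w) = p w.
Proof.
apply/eqP; rewrite -subr_eq0 -normr_le0; apply: (@le_small _ (2 + N.+1%:R)); first by rewrite addr_ge0.
move=> d d0.
have [n [i [n0n _ ni]]] := near_freq (size w).+1 (Num.truncn d^-1) d0 ltr01.
have h1 := ni w (leqnSn _).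
have h2 := @sum_near _ _ _ (fun a => a :: w) ni (fun a => leqnn _).
have h3 := frequency_cons R n.+1 (padded i) w.
have h4 : n.+1%:R^-1 <= d.
  rewrite invf_ple ?posrE ?ltr0n// (le_trans (ltW (truncnS_gt _)))// ler_nat//.
move: h4 h1 h2 h3; rewrite /freq/= !ler_norml; move: (n.+1%:R^-1) => x; lra.
Qed.

Let mass_le_count k (d : R) r n c e : (forall u v, word n u = word n v ->
      `|birkhoff_sum phi n u - birkhoff_sum phi n v| <= n%:R * e) ->
    (forall i : n.-tuple A, near_weights k d (freq i) p ->
      birkhoff_sum phi n (padded i) <= n%:R * c) ->
  mass n r [set f | near_weights k d f p] <=
  #|[pred i : n.-tuple A | `[< near_weights k d (freq i) p >]]|%:R * expR (n%:R * (c + e)).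
Proof.
move=> dist avg; set E := expR _.
pose P := [pred i : n.-tuple A | `[< near_weights k d (freq i) p >]].
have -> : #|P|%:R * E = \sum_(i in P) E by rewrite sumr_const [LHS]mulr_natl.
rewrite /mass [leLHS]big_mkcond [leRHS]big_mkcond; apply: ler_sum => i _.
case: ifPn => [/andP[_ ni]|_]; last by case: ifP => // _; exact: expR_ge0.
rewrite inE ni; apply: cylinder_sup_le => u ui.
have := dist u (padded i); rewrite word_padded => /(_ ui).
have := avg i (asboolW ni); rewrite mulrDr ler_norml; lra.
Qed.

Section limit_state.
Variable mu : probability (borel_strings N) R.
Hypothesis muE : forall k (w : k.-tuple A), word_law mu w = p w.

Let limit_invariant : invariant_measure mu S.
Proof.
apply: invariant_word => k w.
have mcyl : measurable ([set u | word k u = w] : set (borel_strings N)) by exact: label_word.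
have mS : measurable ((S : borel_strings N -> borel_strings N) @^-1` [set u | word k u = w]).
  by rewrite -[X in measurable X]setTI; exact: (@measurable_shift N).
have wE : word k \o S = (fun w' : k.+1.-tuple A => [tuple of behead w']) \o
    (word k.+1 : borel_strings N -> _).
  apply/funext => u; apply: eq_from_tnth => j.
  by rewrite [RHS]tnth_behead !tnth_mktuple /shift_map /= inordK// ltnS.
rewrite -(fineK (fin_num_measure mu _ mS)) -(fineK (fin_num_measure mu _ mcyl)); congr EFin.
have -> : fine (mu [set u | word k u = w]) = p w by rewrite -muE.
have -> : fine (mu ((S : borel_strings N -> borel_strings N) @^-1` [set u | word k u = w])) =
    law mu (word k \o S) w by [].
rewrite wE law_comp; last exact: label_word.
rewrite -p_cons (reindex_onto (fun a => [tuple of a :: w]) (fun w' => thead w'))/=; last first.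
  by move=> w' /eqP <-; apply: val_inj => /=; case/tupleP: w' => a t; rewrite theadE /=.
apply: eq_big => [a|a _]; last exact: muE.
by rewrite theadE eqxx andbT -val_eqE /= eqxx.
Qed.

Let word_close_near k d n (i : n.+1.-tuple A) : near_weights k d (freq i) p ->
  word_close k d mu (empirical R n.+1 (padded i)).
Proof.
by move=> ni j w jk; rewrite frequencyE muE; apply: ni; rewrite size_tuple.
Qed.

(** For a long word with frequencies close to [p] and inside the [e / 2]-neighbourhood, the image of
    the empirical measure is within [e / 2] of [U mu] and of a point of [C]. *)
Let limit_closure : closure C (U mu).
Proof.
move=> B /nbhs_ballP[e /= e0 eB].
have e2 : 0 < e / 2 by rewrite divr_gt0.
have [k [d [d0 kd]]] := weak_continuous_close cU (nbhsx_ballx (U mu) _ e2).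
have [n [i [_ ir ni]]] := near_freq k 0 d0 e2.
have UB := kd _ (word_close_near ni).
have : neighborhood C (e / 2) (U (empirical R n.+1 (padded i))).
  move/asboolP : ir; apply; exists (padded i) => //.
  by rewrite cylinderE; exact: word_padded.
rewrite /neighborhood /= => /ereal_inf_lt[_ [c Cc <-]]; rewrite lte_fin => Uc.
exists c; split => //; apply: eB; rewrite ballEmdist /=.
move: UB; rewrite ballEmdist /= => UB.
by rewrite (le_lt_trans (metric_triangle _ (U (empirical R n.+1 (padded i))) _))// [ltRHS]splitr ltrD.
Qed.

(** Words with frequencies near [p] have mass above [expR (- (n * e))]; each contributes about
    [expR (n * P)], and their number is at most about [expR (n * H / m)]. The exponents are
    compared. *)
Let limit_entropy m : (0 < m)%N ->
  0 <= m%:R^-1 * shannon mu (word m : borel_strings N -> _) + \int[mu]_x phi x.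
Proof.
move=> m0; set H := shannon _ _; set P := \int[mu]_x _.
have m1 : 1 <= m%:R :> R by rewrite ler1n.
apply/ler_addgt0Pl => e0 e00; rewrite addrC.
(* One [e] each for the mass, the prefactor [B], the integral of [phi] and the distortion, and two
   for the cost: the mixture with the uniform law and the deviation of the frequencies. *)
pose e := e0 / 6; have e1 : 0 < e by rewrite divr_gt0.
pose M : R := (N.+1 ^ m)%:R; have M0 : 0 < M by rewrite ltr0n expn_gt0.
(* Mixing with the uniform law makes all logarithms finite. *)
pose q (w : m.-tuple A) := expR (- e) * p w + (1 - expR (- e)) / M.
have E1 : expR (- e) < 1 by rewrite -[ltRHS]expR0 ltr_expR oppr_lt0.
have E0 : 0 < expR (- e) :> R by exact: expR_gt0.
have q0 w : 0 < q w.
  by rewrite /q ltr_wpDl ?divr_gt0 ?subr_gt0// mulr_ge0// ltW.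
have sump : \sum_(w : m.-tuple A) p w = 1.
  under eq_bigr do rewrite -muE.
  by apply: law_sum1; exact: label_word.
have q1 : \sum_w q w <= 1.
  rewrite big_split/= -mulr_sumr sump mulr1 sumr_const card_tuple card_ord.
  by rewrite -[X in _ + X]mulr_natr mulfVK ?gt_eqF// addrC subrK.
pose L := 1 + \sum_w `|ln (q w)|.
have L0 : 0 < L by rewrite ltr_pwDl// sumr_ge0.
have pq : \sum_(w : m.-tuple A) p w * - ln (q w) <= H + e.
  have -> : H + e = \sum_(w : m.-tuple A) (eta (p w) + p w * e).
    rewrite big_split/= -mulr_suml sump mul1r; congr (_ + _).
    by apply: eq_bigr => w _; rewrite -muE.
  apply: ler_sum => w _; have := p_ge0 w; rewrite le_eqVlt => /predU1P[<-|pw0].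
    by rewrite /eta !mul0r oppr0 addr0.
  rewrite /eta -mulrN -mulrDr ler_wpM2l ?(ltW pw0)//.
  have : ln (expR (- e) * p w) <= ln (q w).
    rewrite ler_ln ?posrE ?mulr_gt0// /q lerDl divr_ge0 ?(ltW M0)// subr_ge0 ltW//.
  rewrite lnM ?posrE// expRK; lra.
have [k2 [d2 [d20 kd2]]] := Rintegral_close mu cphi e1.
have [n1 dist] := birkhoff_distortion cphi e1.
pose d := Num.min (e / L) d2.
have d0 : 0 < d by rewrite lt_min d20 divr_gt0.
pose k := maxn m k2.
pose B := m%:R * M ^+ 2.
have B0 : 0 < B by rewrite mulr_gt0 ?exprn_gt0// ltr0n.
have [n [n0n n0 massn]] :=
  @mass_large k d 1 e (maxn n1 (Num.truncn (ln B / e)).+1) d0 ltr01 e1.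
move: n0n; rewrite geq_max => /andP[n1n nB].
have n0' : 0 < n%:R :> R by rewrite ltr0n.
have Bn : B <= expR (n%:R * e).
  rewrite -[leLHS]lnK ?posrE// ler_expR -ler_pdivrMr//.
  by rewrite (le_trans (ltW (truncnS_gt _)))// ler_nat.
have avg (i : n.-tuple A) : near_weights k d (freq i) p ->
    birkhoff_sum phi n (padded i) <= n%:R * (P + e).
  case: n n0 n0' i {n1n nB massn Bn} => // n _ n0' i ni.
  have : word_close k2 d2 mu (empirical R n.+1 (padded i)).
    move=> j w jk; rewrite (le_trans (word_close_near ni _ _)) ?ge_min ?lexx ?orbT//.
    by rewrite (leq_trans jk)// leq_maxr.
  move=> /kd2; rewrite Rintegral_empirical// ler_norml => /andP[_].
  by rewrite lerBlDl ler_pdivrMl.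
have cost (i : n.-tuple A) : near_weights k d (freq i) p ->
    \sum_(t < n) - ln (q (word m (iter t (@shift_map N) (padded i)))) <= n%:R * (H + 2 * e).
  move=> ni.
  have -> : \sum_(t < n) - ln (q (word m (iter t (@shift_map N) (padded i)))) =
      n%:R * \sum_(w : m.-tuple A) freq i w * - ln (q w).
    have fE w : freq i w = n%:R^-1 *
        \sum_(t < n) (starts_with w (iter t (@shift_map N) (padded i)))%:R by [].
    rewrite mulr_sumr; under [RHS]eq_bigr do rewrite fE -mulrA mulrA mulfV ?gt_eqF// mul1r mulr_suml.
    rewrite exchange_big/=; apply: eq_bigr => t _.
    rewrite (bigD1 (word m (iter t (@shift_map N) (padded i))))// starts_withE eqxx mul1r.
    rewrite big1 => [|w]; first by rewrite /= addr0.
    rewrite starts_withE eq_sym => /negbTE ->.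
    by rewrite mul0r.
  rewrite ler_wpM2l ?(ltW n0')//.
  have : \sum_(w : m.-tuple A) freq i w * - ln (q w) - \sum_(w : m.-tuple A) p w * - ln (q w) <= e.
    rewrite -sumrB (@le_trans _ _ (\sum_(w : m.-tuple A) d * `|ln (q w)|))//.
      apply: ler_sum => w _; rewrite -mulrBl (le_trans (ler_norm _))// normrM normrN.
      by rewrite ler_wpM2r// ni// size_tuple leq_maxl.
    rewrite -mulr_sumr (@le_trans _ _ (d * L))//; first by rewrite ler_wpM2l ?(ltW d0)// /L lerDr.
    by rewrite -ler_pdivlMr// ge_min lexx.
  lra.
have count : #|[pred i : n.-tuple A | `[< near_weights k d (freq i) p >]]|%:R <=
    B * expR (n%:R * (H + 2 * e) / m%:R).
  apply: le_trans (card_words_le n m0 q0 q1 _); rewrite ler_nat.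
  by apply: subset_leq_card; apply/fintype.subsetP => i; rewrite !inE; exact: cost.
have := lt_le_trans massn (mass_le_count 1 (dist n n1n) avg).
move=> /lt_le_trans/(_ (ler_wpM2r (expR_ge0 _) count)).
move=> /lt_le_trans/(_ (ler_wpM2r (expR_ge0 _) (ler_wpM2r (expR_ge0 _) Bn))).
rewrite -!expRD ltr_expR.
have -> : n%:R * e + n%:R * (H + 2 * e) / m%:R + n%:R * (P + e + e) =
   n%:R * (e + (H + 2 * e) / m%:R + (P + e + e)) by ring.
rewrite -mulrN ltr_pM2l// mulrDl [_ / m%:R]mulrC.
have : 2 * e / m%:R <= 2 * e by rewrite ler_pdivrMr ?ltr0n// ler_peMr// mulr_ge0// ltW.
have -> : e0 = 6 * e by rewrite /e; field.
lra.
Qed.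

Lemma limit_state : [/\ invariant_measure mu S, closure C (U mu) &
  forall m, (0 < m)%N ->
  0 <= m%:R^-1 * shannon mu (word m : borel_strings N -> _) + \int[mu]_x phi x].
Proof. by split. Qed.

End limit_state.

(** The inequality is kept for each block length, with one [mu] for all; the entropy appears only
    when [m] tends to infinity. *)
Lemma equilibrium_state : exists mu : probability (borel_strings N) R,
  [/\ invariant_measure mu S, closure C (U mu) &
      forall m, (0 < m)%N ->
      0 <= m%:R^-1 * shannon mu (word m : borel_strings N -> _) + \int[mu]_x phi x].
Proof.
have [mu muE] := kolmogorov_words p_ge0 p_nil p_rcons.
by exists mu; exact: limit_state.
Qed.

End upper_bound.

(** * Pressure, radius of convergence and conclusion *)

Lemma ereal_between (R : realType) (x : \bar R) (c : R) : (x < c%:E)%E -> exists2 b : R, (x < b%:E)%E & b < c.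
Proof.
case: x => [x||]; rewrite ?lte_fin ?ltye_eq// => xc.
  by exists ((x + c) / 2); rewrite ?lte_fin; lra.
by exists (c - 1); rewrite ?ltNyr// ltrBlDr ltrDl.
Qed.

Section convergence_radius.
Variables (R : realType) (N : nat) (X : metricType R).
Variables (U : weak_probability R N -> X) (V : set X) (phi : strings N -> R).
Hypothesis cphi : continuous phi.

Let Z n := partition_sum U V phi n.

Let Z_ge0 n : 0 <= Z n.
Proof. by apply: sumr_ge0 => i _; exact: cylinder_sup_ge0. Qed.

Let upper_pressure_lt (c : R) : (upper_pressure U V phi < c%:E)%E ->
  exists n0, forall n, (n0 <= n)%N -> Z n <= expR (n%:R * c).
Proof.
move=> /ereal_inf_lt[_ [W [n0 _ n0W] <-]] Wc.
exists (maxn n0 1) => n; rewrite geq_max => /andP[n0n n1].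
have [Z0|Z0] := ltP 0 (Z n); last by rewrite (le_trans Z0)// expR_ge0.
have n1' : 0 < n%:R :> R by rewrite ltr0n.
have : ((n%:R^-1)%:E * lne (Z n)%:E < c%:E)%E.
  by apply: le_lt_trans Wc; apply: ereal_sup_ubound; exists n => //; exact: n0W.
rewrite lne_EFin// -EFinM lte_fin ltr_pdivrMl// => h.
by rewrite -[leLHS]lnK ?posrE// ler_expR ltW.
Qed.

(** For [b] between the pressure and [c], the terms at [expR (- c)] are eventually dominated by a
    geometric series of ratio [expR (b - c)]. *)
Lemma radius_ge (c : R) : (upper_pressure U V phi < c%:E)%E ->
  ((expR (- c))%:E <= convergence_radius (zeta_coef U V phi))%E.
Proof.
move=> /ereal_between[b /upper_pressure_lt[n0 h] bc].
apply: ereal_sup_ubound; exists (expR (- c)); last by rewrite ger0_norm// expR_ge0.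
pose u n := zeta_coef U V phi n * expR (- c) ^+ n.
pose q := expR (b - c).
have q0 n : 0 < q ^+ n by rewrite exprn_gt0// expR_gt0.
have qlt : `|q| < 1.
  by rewrite ger0_norm ?expR_ge0// -[ltRHS]expR0 ltr_expR subr_lt0.
have u0 n : 0 <= u n.
  by rewrite mulr_ge0 ?exprn_ge0 ?expR_ge0// mulr_ge0// invr_ge0.
(* The sum covers the terms before [n0], the 1 those from [n0] on. *)
pose K := 1 + \sum_(k < n0) u k / q ^+ k.
have uK n : u n <= geometric K q n.
  have uq k : 0 <= u k / q ^+ k by rewrite mulr_ge0// invr_ge0 ltW.
  rewrite /= -ler_pdivrMr//; have [nn0|n0n] := ltnP n n0.
    by rewrite /K (bigD1 (Ordinal nn0))//= addrCA lerDl addr_ge0// sumr_ge0.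
  apply: (@le_trans _ _ 1); last by rewrite lerDl sumr_ge0.
  rewrite ler_pdivrMr// mul1r /u /zeta_coef.
  have -> : q ^+ n = expR (n%:R * b) * expR (- c) ^+ n.
    by rewrite /q expRD exprMn expRM_natl.
  rewrite ler_wpM2r ?exprn_ge0 ?expR_ge0//.
  apply: (@le_trans _ _ (Z n)); last exact: h.
  case: n {n0n} => [|n]; first by rewrite invr0 mul0r.
  by rewrite ler_piMl// invf_le1 ?ltr0n// ler1n.
apply: (series_le_cvg u0 _ uK); last exact: is_cvg_geometric_series.
by move=> n; exact: le_trans (u0 n) (uK n).
Qed.

(** Convergence at [z] bounds the terms, so that [Z n <= n * expR (n * b)] eventually, with
    [b = - ln |z|]; if [b < c], the pressure would be at most [c]. *)
Lemma radius_le (c : R) : (c%:E < upper_pressure U V phi)%E ->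
  (convergence_radius (zeta_coef U V phi) <= (expR (- c))%:E)%E.
Proof.
move=> cP; apply: ge_ereal_sup => _ [z /= cz <-]; rewrite lee_fin leNgt; apply/negP => zc.
have z0 : 0 < `|z| by rewrite (lt_trans _ zc)// expR_gt0.
pose b := - ln `|z|.
have bc : b < c by rewrite /b ltrNl -(expRK (- c)) ltr_ln ?posrE ?expR_gt0.
have c0 := cvg_series_cvg_0 cz.
have [n1 _ hn1] := (cvgrPdist_le _ _).1 c0 1 ltr01.
suff : (upper_pressure U V phi <= c%:E)%E by rewrite leNgt cP.
pose d := (c - b) / 2; have d0 : 0 < d by rewrite divr_gt0// subr_gt0.
(* From [n >= d ^- 2] follows [n <= (n * d) ^+ 2 <= expR (n * d) ^+ 2], and [2 * d = c - b] absorbs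
   the factor [n]. *)
apply: (@upper_pressure_le_rate _ _ _ _ _ _ _ (maxn (maxn n1 1) (Num.truncn (d ^- 2)).+1)) => n.
rewrite !geq_max => /andP[/andP[n1n n0] nd].
have n0' : 0 < n%:R :> R by rewrite ltr0n.
have := hn1 n n1n; rewrite /= sub0r normrN normrM normrX /zeta_coef normrM normfV.
rewrite (ger0_norm (ltW n0')) (ger0_norm (Z_ge0 n)) => hz.
have zE : `|z| ^+ n = expR (- (n%:R * b)).
  by rewrite /b mulrN opprK mulrC expRM_natr lnK// posrE.
have Zn : Z n <= n%:R * expR (n%:R * b).
  by move: hz; rewrite zE expRN ler_pdivrMr ?expR_gt0// mul1r ler_pdivrMl.
rewrite (le_trans Zn)//.
have -> : n%:R * c = n%:R * b + (n%:R * d + n%:R * d) by rewrite /d; field.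
rewrite !expRD mulrC ler_wpM2l ?expR_ge0//.
have nd1 : n%:R * d <= expR (n%:R * d) by rewrite (le_trans _ (expR_ge1Dx _))// lerDr.
have nd0 : 0 <= n%:R * d by rewrite mulr_ge0// ltW.
apply: le_trans (ler_pM nd0 nd0 nd1 nd1).
rewrite mulrACA -expr2 -[leLHS]mulr1 -mulrA ler_wpM2l// -expr2.
rewrite -ler_pdivrMr ?exprn_gt0// mul1r (le_trans (ltW (truncnS_gt _)))// ler_nat//.
Qed.

End convergence_radius.

(** * Upper limits as the radius tends to 0 *)

Section right_limits.
Variables (R : realType) (f : R -> \bar R).

Lemma limf_esup_at_right_nondecreasing :
    (forall x y, 0 < x -> x <= y -> (f x <= f y)%E) ->
  limf_esup f 0^'+ = ereal_inf [set f x | x in [set x | 0 < x]].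
Proof.
move=> nf; apply/eqP; rewrite eq_le; apply/andP; split.
  apply: le_ereal_inf_tmp => _ [x /= x0 <-].
  apply: (@le_trans _ _ (ereal_sup (f @` [set y | 0 < y <= x]))).
    apply: ereal_inf_lbound; exists [set y | 0 < y <= x] => //.
    near=> y; apply/andP; split; first by near: y; exact: nbhs_right_gt.
    by near: y; exact: nbhs_right_le.
  by apply: ge_ereal_sup => _ [y /= /andP[y0 yx] <-]; exact: nf.
apply: le_ereal_inf_tmp => _ [W FW <-].
have [y [y0 Wy]] : exists y, 0 < y /\ W y.
  have : \forall y \near 0^'+, 0 < y /\ W y by apply: filterI => //; exact: nbhs_right_gt.
  by move=> /filter_ex.
apply: (@le_trans _ _ (f y)); first by apply: ereal_inf_lbound; exists y.
by apply: ereal_sup_ubound; exists y.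
Unshelve. all: by end_near. Qed.

End right_limits.

Section monotonicity.
Variables (R : realType) (N : nat) (X : metricType R).
Variables (U : weak_probability R N -> X) (phi : strings N -> R).
Hypothesis cphi : continuous phi.

Lemma neighborhood_le (C : set X) (r r' : R) : r <= r' ->
  neighborhood C r `<=` neighborhood C r'.
Proof. by move=> rr x /lt_le_trans; apply; rewrite lee_fin. Qed.

Lemma partition_sum_le (V V' : set X) n : V `<=` V' ->
  0 <= partition_sum U V phi n <= partition_sum U V' phi n.
Proof.
move=> VV; apply/andP; split; first by apply: sumr_ge0 => i _; exact: cylinder_sup_ge0.
rewrite /partition_sum [leLHS]big_mkcond [leRHS]big_mkcond; apply: ler_sum => i _.
case: ifPn => [/asboolP iV|_]; last by case: ifP => // _; exact: cylinder_sup_ge0.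
by rewrite asboolT//; exact: subset_trans VV.
Qed.

Lemma upper_pressure_le (V V' : set X) : V `<=` V' ->
  (upper_pressure U V phi <= upper_pressure U V' phi)%E.
Proof.
move=> VV; apply: le_ereal_inf_tmp => _ [W FW <-].
apply: (@le_trans _ _ (ereal_sup
    ((fun n => (n%:R^-1)%:E * lne (partition_sum U V phi n)%:E)%E @` W))).
  by apply: ereal_inf_lbound; exists W.
apply: ge_ereal_sup => _ [n Wn <-].
apply: (@le_trans _ _ ((n%:R^-1)%:E * lne (partition_sum U V' phi n)%:E)%E).
  apply: lee_wpmul2l; first by rewrite lee_fin invr_ge0.
  have /andP[Z0 ZZ] := @partition_sum_le V V' n VV.
  by rewrite lee_lne ?in_itv/= ?lee_fin ?leey ?andbT// (le_trans Z0).
by apply: ereal_sup_ubound; exists n.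
Qed.

End monotonicity.

Section radius_and_pressure.
Variables (R : realType) (N : nat) (X : metricType R).
Variables (U : weak_probability R N -> X) (C : set X) (phi : strings N -> R).
Hypothesis cphi : continuous phi.

Let P r := upper_pressure U (neighborhood C r) phi.
Let G r := convergence_radius (zeta_coef U (neighborhood C r) phi).

Lemma limf_pressureE :
  limf_esup P 0^'+ = ereal_inf [set P r | r in [set r | 0 < r]].
Proof.
apply: limf_esup_at_right_nondecreasing => x y _ xy.
by apply: upper_pressure_le => //; exact: neighborhood_le.
Qed.

Let limf_radius_ge (c : R) : (limf_esup P 0^'+ < c%:E)%E ->
  ((expR (- c))%:E <= limf_esup G 0^'+)%E.
Proof.
rewrite limf_pressureE => /ereal_inf_lt[_ [x /= x0 <-]] xc.
apply: le_ereal_inf_tmp => _ [W FW <-].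
have [y [yx Wy]] : exists y, y <= x /\ W y.
  have : \forall y \near 0^'+, y <= x /\ W y by apply: filterI => //; exact: nbhs_right_le.
  by move=> /filter_ex.
apply: (@le_trans _ _ (G y)); last by apply: ereal_sup_ubound; exists y.
apply: (radius_ge cphi (c := c)); apply: le_lt_trans xc.
by apply: (upper_pressure_le U cphi); exact: neighborhood_le.
Qed.

Let limf_radius_le (c : R) : (c%:E < limf_esup P 0^'+)%E ->
  (limf_esup G 0^'+ <= (expR (- c))%:E)%E.
Proof.
rewrite limf_pressureE => cP.
apply: (@le_trans _ _ (ereal_sup (G @` [set x | 0 < x]))).
  by apply: ereal_inf_lbound; exists [set x | 0 < x] => //; exact: nbhs_right_gt.
apply: ge_ereal_sup => _ [x /= x0 <-]; apply: (radius_le cphi).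
by apply: lt_le_trans cP _; apply: ereal_inf_lbound; exists x.
Qed.

(** The radius is the exponential of minus the pressure, known only through strict comparisons; each
    equality is tested at levels on both sides. *)
Lemma pressure0_radius1 : limf_esup P 0^'+ = 0%E <-> limf_esup G 0^'+ = 1%E.
Proof.
split=> [P0|G1].
  apply/eqP; rewrite eq_le; apply/andP; split.
    apply/lee_addgt0Pr => e e0; rewrite -EFinD.
    have e1 : 0 < 1 + e by lra.
    rewrite -[1 + e]lnK ?posrE// -[ln _]opprK; apply: limf_radius_le.
    by rewrite P0 lte_fin oppr_lt0 ln_gt0// ltrDl.
  apply/lee_addgt0Pr => e e0; rewrite -leeBlDr// -EFinB.
  apply: le_trans (limf_radius_ge (c := e) _); last by rewrite P0 lte_fin.
  by rewrite lee_fin expR_ge1Dx.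
apply/eqP; rewrite eq_le !leNgt; apply/andP; split; apply/negP => h.
  have : (- limf_esup P 0^'+ < 0%:E)%E by rewrite oppe_lt0.
  move=> /ereal_between[b Pb b0].
  have /limf_radius_le : ((- b)%:E < limf_esup P 0^'+)%E by rewrite EFinN lteNl.
  rewrite G1 lee_fin opprK leNgt -[ltRHS]expR0 ltr_expR.
  by rewrite b0.
have [b Pb b0] := ereal_between h.
have := limf_radius_ge Pb; rewrite G1 lee_fin leNgt -[ltLHS]expR0 ltr_expR.
by rewrite oppr_gt0 b0.
Qed.

End radius_and_pressure.

Section entropy_bounds.
Variables (R : realType) (N : nat).
Local Notation A := 'I_N.+1.
Local Notation S := (@shift_map N : borel_strings N -> borel_strings N).
Variable mu : probability (borel_strings N) R.

(** One partition is enough, that by the first letter, whose itineraries are the words. *)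
Lemma entropy_ge (c : R) : invariant_measure mu S ->
    (forall m, (0 < m)%N -> c <= m%:R^-1 * shannon mu (word m : borel_strings N -> _)) ->
  (c%:E <= entropy mu S)%E.
Proof.
move=> muS h; pose xi (u : borel_strings N) : A := u 0%N.
have mxi : label xi by apply: (@label_factor _ _ 1) => u v /wordP; apply.
apply: le_trans (ereal_sup_ubound _); last by exists N.+1, xi; split.
rewrite lee_fin; have [cxi _] := partition_entropy_cvg (@measurable_shift N) muS mxi.
apply: (cvgr_to_ge cxi); exists 1%N => // n /= n1.
rewrite (_ : itinerary S xi n = word n); first exact: h.
by apply/funext => u; apply: eq_from_tnth => i; rewrite !tnth_mktuple /xi iter_shift addn0.
Qed.

Lemma continuous_lt0_bound (g : strings N -> R) : continuous g -> (forall u, g u < 0) ->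
  exists2 a, 0 < a & forall u, g u <= - a.
Proof.
move=> cg g0.
have [n _ gn] : \forall n \near \oo, [set: strings N] `<=` (fun u => g u <= - n.+1%:R^-1).
  apply: (compact_near_coveringP _).1; first exact: strings_compact.
  move=> u _; have gu : 0 < - g u / 2 by rewrite divr_gt0// oppr_gt0.
  have nu : nbhs u [set v | `|g u - g v| < - g u / 2].
    by move/cvgrPdist_lt : (cg u) => /(_ _ gu).
  exists ([set v | `|g u - g v| < - g u / 2],
      [set n | (Num.truncn (- g u / 2)^-1 <= n)%N]).
    by split=> //=; exists (Num.truncn (- g u / 2)^-1).
  move=> [v n] [/= uv un].
  have : n.+1%:R^-1 <= - g u / 2.
    by rewrite invf_ple ?posrE ?ltr0n// (le_trans (ltW (truncnS_gt _)))// ler_nat.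
  move: uv; rewrite ltr_norml; move: (n.+1%:R^-1) => x; lra.
exists n.+1%:R^-1; first by rewrite invr_gt0.
by move=> u; apply: (gn n (leqnn n)).
Qed.

Lemma Rintegral_lt0 (g : strings N -> R) : continuous g -> (forall u, g u < 0) ->
  \int[mu]_x g x < 0.
Proof.
move=> cg /(continuous_lt0_bound cg)[a a0 ga].
have ca : continuous (fun _ : strings N => - a).
  by apply: word_continuous => e e0; exists 0%N => u v _; rewrite subrr normr0 ltW.
rewrite (@le_lt_trans _ _ (\int[mu]_x (- a)))//.
  apply: le_Rintegral => //.
  - exact: (continuous_integrable_strings _ cg).
  - exact: (continuous_integrable_strings _ ca).
rewrite Rintegral_cst//.
have -> : fine (mu setT) = 1 by rewrite probability_setT.
by rewrite mulr1 oppr_lt0.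
Qed.

End entropy_bounds.

(** The triangle inequality, with half the radius on each side. It lets measures with [U mu] in the
    closure enter the lower bound at every radius. *)
Lemma neighborhood_closure (R : realType) (X : metricType R) (C : set X) x (r : R) :
  0 < r -> closure C x -> nbhs x (neighborhood C r).
Proof.
move=> r0 Cx; have r2 : 0 < r / 2 by rewrite divr_gt0.
apply/nbhs_ballP; exists (r / 2) => // y; rewrite ballEmdist /= => xy.
have [c [Cc]] := Cx _ (nbhsx_ballx x _ r2); rewrite ballEmdist /= => xc.
rewrite /neighborhood /=; apply: (@le_lt_trans _ _ (mdist y c)%:E).
  by apply: ereal_inf_lbound; exists c.
rewrite lte_fin (le_lt_trans (metric_triangle _ x _))// [ltRHS]splitr ltrD//.
by rewrite metric_sym.
Qed.

Unset Implicit Arguments.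
Set Strict Implicit.

Theorem corollary5p4 (R : realType) (N : nat) (X : metricType R)
    (U : weak_probability R N -> X) (U_continuous : continuous U)
    (C : set X)
    (Phi : strings N -> R) (Phi_continuous : continuous Phi)
    (Phi_lt0 : forall u, Phi u < 0)
    (s : R) :
  (limf_esup (fun r : R =>
       upper_pressure U (neighborhood C r) (fun u => s * Phi u)) 0^'+ = 0%E
   <->
   limf_esup (fun r : R =>
       convergence_radius
         (zeta_coef U (neighborhood C r) (fun u => s * Phi u))) 0^'+ = 1%E)
  /\
  (limf_esup (fun r : R =>
       upper_pressure U (neighborhood C r) (fun u => s * Phi u)) 0^'+ = 0%E ->
   s%:E = ereal_sup
     [set (- (entropy mu (@shift_map N) / (\int[mu]_u Phi u)%R%:E))%E
        | mu in [set mu : probability (borel_strings N) R |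
                  invariant_measure mu (@shift_map N) /\ closure C (U mu)]]).
Proof.
have cphi : continuous (fun u => s * Phi u).
  apply: word_continuous => e e0; pose M := `|s| + 1.
  have M0 : 0 < M by rewrite ltr_wpDl.
  have [k hk] := continuous_word Phi_continuous (divr_gt0 e0 M0).
  exists k => u v /hk uv; rewrite -mulrBr normrM.
  rewrite (@le_trans _ _ (M * (e / M)))//; first by rewrite ler_pM// /M lerDl.
  by rewrite mulrCA mulfV ?gt_eqF// mulr1.
split; first exact: pressure0_radius1.
rewrite limf_pressureE// => P0.
have intE (mu : probability (borel_strings N) R) :
    \int[mu]_x (s * Phi x) = s * \int[mu]_x Phi x.
  by rewrite RintegralZl//; exact: (continuous_integrable_strings _ Phi_continuous).
(* The integral is a negative real, so the quotient with its sign is a product with a nonnegative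
   real, also for infinite [h]; inequalities on the entropy carry over. *)
have ratio (mu : probability (borel_strings N) R) (h : \bar R) :
    (- (h / (\int[mu]_u Phi u)%R%:E) = h * (- (\int[mu]_u Phi u)^-1)%R%:E)%E.
  by rewrite inver lt_eqF ?Rintegral_lt0// EFinN muleN.
have ratio_s (mu : probability (borel_strings N) R) :
    (s%:E = (- (s * \int[mu]_x Phi x))%:E * (- (\int[mu]_u Phi u)^-1)%R%:E)%E.
  by rewrite -EFinM mulrNN mulfK// lt_eqF// Rintegral_lt0.
have inv_ge0 (mu : probability (borel_strings N) R) :
    (0 <= (- (\int[mu]_u Phi u)^-1)%:E)%E.
  by rewrite lee_fin oppr_ge0 invr_le0 ltW// Rintegral_lt0.
apply/eqP; rewrite eq_le; apply/andP; split.
  (* Monotonicity in the radius has turned the upper limit into an infimum, so its vanishing bounds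
     every pressure from below. *)
  have Pge r : 0 < r -> (0 <= upper_pressure U (neighborhood C r) (fun u => (s * Phi u)%R))%E.
    by move=> r0; rewrite -P0; apply: ereal_inf_lbound; exists r.
  have [mu [muS Cmu ent]] := equilibrium_state U_continuous cphi Pge.
  apply: (@le_trans _ _ (- (entropy mu (@shift_map N) / (\int[mu]_u Phi u)%R%:E))%E); last first.
    by apply: ereal_sup_ubound; exists mu.
  rewrite ratio (ratio_s mu); apply: lee_wpmul2r => //.
  apply: entropy_ge => // m /ent; rewrite intE; lra.
apply: ge_ereal_sup => _ [mu [muS Cmu] <-]; rewrite ratio (ratio_s mu).
(* The entropy being a supremum, one partition at a time is compared with the pressures of all
   radii, whose infimum is 0. *)
apply: lee_wpmul2r => //; apply: ge_ereal_sup => _ [k [xi [mxi ->]]].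
have : ((partition_entropy mu (@shift_map N) xi + \int[mu]_x (s * Phi x))%:E <= 0)%E.
  rewrite -P0; apply: le_ereal_inf_tmp => _ [r /= r0 <-].
  by apply: upper_pressure_ge => //; exact: neighborhood_closure.
rewrite intE !lee_fin; lra.
Qed.
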